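(* Let $G$ be a countably infinite discrete amenable group, $(X,G)$ a $G$-action on a nonempty compact metric space $(X,d)$, and $\{F_n\}_{n\in\mathbb{N}}$ a tempered F\o lner sequence of $G$ satisfying $\lim_{n\to\infty}\frac{|F_n|}{\log n}=+\infty$. For $\varepsilon>0$ and $x\in X$ let $\Gamma_\varepsilon(x)=\{y\in X: d(gx,gy)\le\varepsilon\ \text{for all } g\in G\}$. Then for every $\varepsilon>0$, $$\overline{\mathrm{mdim}}_{M}(X,\{F_n\}_{n\in\mathbb{N}},d)=\limsup_{\delta\to 0}\sup_{x\in X}\frac{h_{\mathrm{top}}(\Gamma_{\varepsilon}(x),\delta,\{F_{n}\}_{n\in\mathbb{N}},d)}{\log\frac{1}{\delta}}$$ $$=\limsup_{\delta\to 0}\sup_{x\in X}\frac{h_{\mathrm{top}}^{P}(\Gamma_{\varepsilon}(x),\delta,\{F_{n}\}_{n\in\mathbb{N}},d)}{\log\frac{1}{\delta}}=\limsup_{\delta\to 0}\sup_{x\in X}\frac{h_{\mathrm{top}}^{B}(\Gamma_{\varepsilon}(x),\delta,\{F_{n}\}_{n\in\mathbb{N}},d)}{\log\frac{1}{\delta}}.$$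
   Context: **Groups and actions.** $G$ is a countably infinite discrete group with identity $e_G$; $\mathfrak{F}_G$ is the collection of finite nonempty subsets of $G$. A F\o lner sequence is a sequence $\{F_n\}_{n\in\mathbb{N}}\subset\mathfrak{F}_G$ with $\lim_{n\to\infty}\frac{|F_n\cap gF_n|}{|F_n|}=1$ for each $g\in G$; $G$ is amenable if one exists. A sequence $\{H_n\}_{n\in\mathbb N}\subset\mathfrak{F}_G$ is tempered if there is a constant $C>0$ independent of $n$ with $\left|\bigcup_{k<n}H_k^{-1}H_n\right|\le C|H_n|$ for every $n\ge 2$. A $G$-action $(X,G)$ is a nonempty compact metric space $(X,d)$ together with the group $G$ acting by self-homeomorphisms of $X$ ($e_G$ acting as the identity). **Balls.** For $F\in\mathfrak{F}_G$, $d_F(x,y)=\max_{g\in F}d(gx,gy)$. $B^F_\varepsilon(x)$ and $O^F_\varepsilon(x)$ are the closed and open balls of center $x$ and radius $\varepsilon$ in the metric $d_F$. **Topological entropy at scale $\delta$.** For nonempty $K\subset X$, $F\in\mathfrak{F}_G$, $\delta>0$: $s_F(K,\delta,d)$ is the maximal cardinality of a set $H\subset K$ with $d_F(x,y)>\delta$ for all distinct $x,y\in H$, and $h_{\mathrm{top}}(K,\delta,\{F_n\}_{n\in\mathbb N},d)=\limsup_{n\to\infty}\frac{1}{|F_n|}\log s_{F_n}(K,\delta,d)$. **Packing entropy at scale $\delta$.** For nonempty $Z\subset X$ and $\lambda,\varepsilon,\delta>0$, $P_{\lambda,\varepsilon}(\delta,Z,\{F_n\},d)=\sup\sum_{i\in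 I}\exp(-\lambda|F_{n_i}|)$, the supremum over all finite or countable families of pairwise disjoint closed balls $\{B^{F_{n_i}}_\delta(x_i)\}_{i\in I}$ with $x_i\in Z$ and $|F_{n_i}|\ge\frac1\varepsilon$ for all $i$ (value $0$ for $Z=\emptyset$). Put $P_\lambda(\delta,Z,\{F_n\},d)=\lim_{\varepsilon\to0}P_{\lambda,\varepsilon}(\delta,Z,\{F_n\},d)$, $\widetilde P_\lambda(\delta,Z,\{F_n\},d)=\inf\{\sum_{i=1}^\infty P_\lambda(\delta,Z_i,\{F_n\},d): Z\subset\bigcup_{i=1}^\infty Z_i\}$, and $h^P_{\mathrm{top}}(Z,\delta,\{F_n\}_{n\in\mathbb N},d)=\inf\{\lambda>0:\widetilde P_\lambda(\delta,Z,\{F_n\},d)=0\}$ (with $\inf\emptyset=+\infty$). **Bowen's dimensional entropy at scale $\delta$.** For nonempty $Z\subset X$ and $\lambda,\varepsilon,\delta>0$, $F_{\lambda,\varepsilon}(\delta,Z,\{F_n\},d)=\inf\sum_{i\in I}\exp(-\lambda|F_{n_i}|)$, the infimum over all finite or countable families of open balls $\{O^{F_{n_i}}_\delta(x_i)\}_{i\in I}$ covering $Z$ (with $x_i\in X$) and $|F_{n_i}|\ge\frac1\varepsilon$ for each $i$. Put $F_\lambda(\delta,Z,\{F_n\},d)=\lim_{\varepsilon\to0}F_{\lambda,\varepsilon}(\delta,Z,\{F_n\},d)$ and $h^B_{\mathrm{top}}(Z,\delta,\{F_n\}_{n\in\mathbb N},d)=\inf\{\lambda>0:F_\lambda(\delta,Z,\{F_n\},d)=0\}$.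 **Upper metric mean dimension.** $\overline{\mathrm{mdim}}_M(X,\{F_n\}_{n\in\mathbb N},d)=\limsup_{\delta\to0}\frac{h_{\mathrm{top}}(X,\delta,\{F_n\}_{n\in\mathbb N},d)}{\log\frac1\delta}\in[0,+\infty]$. *)

(* Defs.v *)
From HB Require Import structures.
From mathcomp Require Import all_boot all_order all_algebra finmap.
From mathcomp Require Import all_classical all_reals all_analysis.

Set Implicit Arguments.
Unset Strict Implicit.
Unset Printing Implicit Defensive.

Import Order.TTheory GRing.Theory Num.Theory.
Import numFieldNormedType.Exports.

Local Open Scope classical_set_scope.
Local Open Scope ring_scope.

(* Sequences indexed by the positive integers are encoded as functions on nat:
   F n stands for F_{n+1}.  This only affects [tempered] (the condition n >= 2
   becomes 0 < n) and the growth condition (log n becomes ln n.+1). *)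

Section Group.
Context (R : realType) (G : groupType).
Implicit Types F : nat -> {fset G}.

Definition folner F :=
  (forall n, F n != fset0) /\
  forall g : G,
    (#|` (F n `&` [fset (g * h)%g | h in F n])%fset |%:R / #|` F n|%:R : R)
      @[n --> \oo] --> (1 : R).

Definition amenable := exists F, folner F.

Definition tempered F :=
  exists2 C : R, 0 < C &
    forall n, (0 < n)%N ->
      #|` (\bigcup_(k <- iota 0 n) [fset (h^-1 * g)%g | h in F k, g in F n])%fset |%:R
        <= C * #|` F n|%:R.

End Group.

Section Action.
Context (R : realType) (G : groupType) (X : metricType R) (act : G -> X -> X).

(* Each act g is then a homeomorphism, with inverse act g^-1. *)
Definition continuous_action :=
  [/\ forall x, act 1%g x = x,
      forall g h x, act (g * h)%g x = act g (act h x) &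
      forall g, continuous (act g)].

(* The maximum over E; the base value 0 is harmless, since mdist >= 0. *)
Definition dynamical_dist (E : {fset G}) (x y : X) : R :=
  \big[Num.max/0]_(g <- E) mdist (act g x) (act g y).

Definition dynamical_cball (E : {fset G}) (r : R) (x : X) : set X :=
  [set y | dynamical_dist E x y <= r].

Definition dynamical_oball (E : {fset G}) (r : R) (x : X) : set X :=
  [set y | dynamical_dist E x y < r].

Definition Gamma (e : R) (x : X) : set X :=
  [set y | forall g, mdist (act g x) (act g y) <= e].

Definition fset_separated (E : {fset G}) (delta : R) (H : {fset X}) :=
  forall x y, x \in H -> y \in H -> x != y -> delta < dynamical_dist E x y.

(* A maximum when X is compact, act is continuous and delta > 0. *)
Definition sep_number (E : {fset G}) (K : set X) (delta : R) : \bar R :=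
  ereal_sup [set #|` H|%:R%:E |
    H in [set H : {fset X} | [set` H] `<=` K /\ fset_separated E delta H]].

Context (F : nat -> {fset G}).

Definition htop (K : set X) (delta : R) : \bar R :=
  limn_esup (fun n => (#|` F n|%:R^-1)%:E * lne (sep_number (F n) K delta))%E.

(* A finite or countable family of balls is given by an index set I : set nat,
   indices k i (the ball i being taken for the metric d_{F (k i)}) and
   centers c i; the values of k and c outside I are irrelevant. *)

Definition family_sum (lambda : R) (I : set nat) (k : nat -> nat) : \bar R :=
  \esum_(i in I) (expR (- (lambda * #|` F (k i)|%:R)))%:E.

Definition packing (eps delta : R) (Z : set X)
    (I : set nat) (k : nat -> nat) (c : nat -> X) :=
  [/\ forall i, I i -> Z (c i),
      forall i, I i -> eps^-1 <= #|` F (k i)|%:R &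
      trivIset I (fun i => dynamical_cball (F (k i)) delta (c i))].

Definition packing_pre (lambda eps delta : R) (Z : set X) : \bar R :=
  ereal_sup [set s | exists I k c,
    packing eps delta Z I k c /\ s = family_sum lambda I k].

Definition packing_lim (lambda delta : R) (Z : set X) : \bar R :=
  lim (packing_pre lambda eps delta Z @[eps --> 0^'+]).

Definition packing_outer (lambda delta : R) (Z : set X) : \bar R :=
  ereal_inf [set (\sum_(0 <= i <oo) packing_lim lambda delta (Zs i))%E |
    Zs in [set Zs : nat -> set X | Z `<=` \bigcup_i Zs i]].

Definition htopP (Z : set X) (delta : R) : \bar R :=
  ereal_inf [set lambda%:E |
    lambda in [set lambda | 0 < lambda /\ packing_outer lambda delta Z = 0%E]].

Definition covering (eps delta : R) (Z : set X)
    (I : set nat) (k : nat -> nat) (c : nat -> X) :=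
  (forall i, I i -> eps^-1 <= #|` F (k i)|%:R) /\
  Z `<=` \bigcup_(i in I) dynamical_oball (F (k i)) delta (c i).

Definition bowen_pre (lambda eps delta : R) (Z : set X) : \bar R :=
  ereal_inf [set s | exists I k c,
    covering eps delta Z I k c /\ s = family_sum lambda I k].

Definition bowen_lim (lambda delta : R) (Z : set X) : \bar R :=
  lim (bowen_pre lambda eps delta Z @[eps --> 0^'+]).

Definition htopB (Z : set X) (delta : R) : \bar R :=
  ereal_inf [set lambda%:E |
    lambda in [set lambda | 0 < lambda /\ bowen_lim lambda delta Z = 0%E]].

Definition upper_mdim : \bar R :=
  limf_esup (fun delta => htop [set: X] delta / (ln delta^-1)%:E)%E 0^'+.

Definition Gamma_mdim (h : set X -> R -> \bar R) (e : R) : \bar R :=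
  limf_esup (fun delta =>
    ereal_sup [set h (Gamma e x) delta / (ln delta^-1)%:E | x in [set: X]])%E
    0^'+.

End Action.

(* Main.v *)
(* Only the bound of the metric mean dimension by the Bowen entropies is hard.
   Fix delta and suppose that all the sets Gamma_e(x) have Bowen entropy
   < lambda at scale delta. By compactness there is a finite set K such that,
   for every x, the closed ball of radius e for d_K around x is covered by
   finitely many Bowen balls, with shapes taken from a long finite segment of
   the Folner sequence and with total weight sum exp(-lambda |F_k|) as small as
   we like. Let D be finite, and let y be in the d_D-ball of radius e around x.
   For each g in D with Kg in D, the point gy lies in one of the balls attached
   to gx, say of shape F_k(g); temperedness lets one select centers g such that
   the tiles F_k(g) g are almost disjoint and cover a fixed proportion kappa
   of D. The selected centers and balls determine the orbit of y on the tiles up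
   to 2 delta, and the weights make the number of possible choices at most
   exp(lambda' t + eta |D|), where t is the size of the tiled part and lambda' is
   slightly larger than lambda. If, for every D, the ball contains at most
   exp(h |D| + M |boundary of D|) separated points, apply this to the part of D
   left untiled: the same holds with h replaced by h - kappa (h - lambda') / 2,
   so the infimum of the admissible h is at most lambda'. Hence
   htop(X, 2 delta) <= c + sup_x htopB(Gamma_e(x), delta), with c depending only
   on e, and c disappears after dividing by log(1/delta).

   The other comparisons hold set by set, up to a constant factor in delta:
   a maximal disjoint family of closed balls yields a cover by balls three times
   as large, and the centers of a disjoint family with a common shape are
   separated; the growth of |F_n| makes the sum over all shapes converge. *)

Require Import Defs.
From mathcomp Require Import all_boot all_order all_algebra finmap.
From mathcomp Require Import all_classical all_reals all_analysis.
From mathcomp Require Import lra.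

Set Implicit Arguments.
Unset Strict Implicit.
Unset Printing Implicit Defensive.

Import Order.TTheory GRing.Theory Num.Theory.
Import numFieldNormedType.Exports.

Local Open Scope classical_set_scope.
Local Open Scope ring_scope.

(** * Tilings by translates of Folner sets *)

(** A cardinality bound stands in for Zorn's lemma: the induction is on the room [n] left below [N],
    and each failure of maximality uses up one unit. *)
Lemma maximal_bounded_fset (T : choiceType) (P : {fset T} -> Prop) (N : nat) :
  P fset0 -> (forall S, P S -> (#|` S| <= N)%N) ->
  exists2 S, P S & forall g, g \notin S -> ~ P (g |` S)%fset.
Proof.
move=> P0 PN.
suff H n : forall S, P S -> (N <= #|` S| + n)%N ->
    exists2 S, P S & forall g, g \notin S -> ~ P (g |` S)%fset.
  by apply: (H N _ P0); rewrite leq_addl.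
elim: n => [|n IH] S PS NS.
  exists S => // g gS /PN; rewrite cardfsU1 gS add1n leqNgt ltnS.
  by rewrite -[X in (N <= X)%N]addn0 NS.
have [mS|] := pselect (forall g, g \notin S -> ~ P (g |` S)%fset).
  by exists S.
move=> /existsNP[g /not_implyP[gS /contrapT Pg]].
by apply: (IH _ Pg); rewrite cardfsU1 gS add1n addSnnS.
Qed.

Lemma card_fset_pred (T : choiceType) (A : {fset T}) (P : pred T) :
  #|` [fset x in A | P x]%fset| = (\sum_(x <- A) P x)%N.
Proof.
rewrite card_fset_sum1 -big_fset_condE big_mkcond /=.
by apply: eq_bigr => x _; case: (P x).
Qed.

Section GroupCovering.
Context (R : realType) (G : groupType).
Implicit Types (E A S D K T : {fset G}) (c g h : G).

Definition rtranslate E c := [fset (h * c)%g | h in E]%fset.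

Lemma in_rtranslate E c g : (g \in rtranslate E c) = ((g * c^-1)%g \in E).
Proof.
apply/imfsetP/idP => [[h /= hE ->]|gE]; first by rewrite mulgK.
by exists (g * c^-1)%g => //; rewrite mulgVK.
Qed.

Lemma card_rtranslate E c : #|` rtranslate E c| = #|` E|.
Proof. by rewrite card_imfset//=; exact: mulIg. Qed.

Lemma card_bigfcup_le (I : choiceType) (S : {fset I}) (f : I -> {fset G}) :
  (#|` \bigcup_(c <- S) f c|%fset <= \sum_(c <- S) #|` f c|)%N.
Proof.
elim/big_rec2 : _ => [|c m T _ IH]; first by rewrite cardfs0.
by rewrite (leq_trans (leq_card_fsetU _ _))// leq_add2l.
Qed.

(** Double counting of the pairs (g, t) with t g^-1 in [E]: for fixed [t] the map sending g to t
    g^-1 is injective, so each [t] in [U] occurs at most [#|E|] times. *)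
Lemma sum_card_translate_cap E A U :
  (\sum_(g <- A) #|` rtranslate E g `&` U|%fset <= #|` U| * #|` E|)%N.
Proof.
have capE g : #|` rtranslate E g `&` U|%fset =
    (\sum_(t <- U) ((t * g^-1)%g \in E))%N.
  rewrite -card_fset_pred; apply: (congr1 (fun B : {fset G} => #|` B|)).
  by apply/fsetP => t; rewrite !inE /= in_rtranslate andbC.
under eq_bigr do rewrite capE.
rewrite exchange_big /= [X in (_ <= X)%N](_ : _ = \sum_(t <- U) #|` E|)%N.
  apply: leq_sum => t _; rewrite -card_fset_pred.
  set B := [fset g in A | _]%fset.
  have <- : #|` [fset (t * g^-1)%g | g in B]%fset| = #|` B|.
    by rewrite card_imfset //= => g h /mulgI /invg_inj.
  apply: fsubset_leq_card; apply/fsubsetP => u /imfsetP[g /=].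
  by rewrite !inE => /andP[_ +] ->.
by rewrite big_const_seq count_predT iter_addn_0 mulnC.
Qed.

(* Take a maximal subset [S] whose translates are almost disjoint: every [E g]
   with [g] in [A] then meets their union in a proportion [a], and one counts
   the incidences. *)
Lemma single_shape_tiling E A (a : R) : E != fset0 -> 0 < a < 1 ->
  exists S, [/\ (S `<=` A)%fset,
    (1 - a) * (#|` S| * #|` E|)%:R <= #|` \bigcup_(c <- S) rtranslate E c|%fset%:R &
    a * #|` A|%:R <= #|` \bigcup_(c <- S) rtranslate E c|%fset%:R].
Proof.
move=> E0 /andP[a0 a1]; set U := fun S => (\bigcup_(c <- S) rtranslate E c)%fset.
have Epos : 0 < #|` E|%:R :> R by rewrite ltr0n cardfs_gt0.
pose P S := (S `<=` A)%fset /\ (1 - a) * (#|` S| * #|` E|)%:R <= #|` U S|%:R.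
have P0 : P fset0 by split; rewrite ?fsub0set// cardfs0 mul0n mulr0.
have PN S : P S -> (#|` S| <= #|` A|)%N by case=> /fsubset_leq_card.
have [S [SA US] maxS] := maximal_bounded_fset P0 PN.
exists S; split => //.
have overlap g : g \in A -> a * #|` E|%:R <= #|` rtranslate E g `&` U S|%fset%:R.
  move=> gA; have [gS|gS] := boolP (g \in S).
    have /fsetIidPl -> : (rtranslate E g `<=` U S)%fset by exact: bigfcup_sup.
    by rewrite card_rtranslate ler_piMl// ltW.
  (* Since [g] cannot be added, its translate brings fewer than (1 - a) |E| new points, so more than
     a |E| of its points are already covered. *)
  have /not_andP[|/negP] := maxS _ gS.
    by case; rewrite fsubUset fsub1set gA.
  rewrite -ltNge /U big_fsetU1//= -/(U S) cardfsU1 gS add1n mulSn natrD.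
  have := cardfsUI (rtranslate E g) (U S).
  rewrite card_rtranslate => /(congr1 (fun n => n%:R : R)); rewrite !natrD.
  move: US; lra.
rewrite -(ler_pM2r Epos) -natrM.
rewrite (le_trans _ (_ : (\sum_(g <- A) #|` rtranslate E g `&` U S|%fset)%:R <= _))//.
  rewrite natr_sum card_fset_sum1 natr_sum mulrAC mulr_sumr big_seq.
  rewrite [leRHS]big_seq; apply: ler_sum => g gA.
  by rewrite mulr1 overlap.
by rewrite ler_nat sum_card_translate_cap.
Qed.

Definition tiling (F : nat -> {fset G}) (k : G -> nat) S :=
  (\bigcup_(c <- S) rtranslate (F (k c)) c)%fset.

Lemma tilingU F k S1 S2 :
  tiling F k (S1 `|` S2)%fset = (tiling F k S1 `|` tiling F k S2)%fset.
Proof.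
apply/fsetP => g; rewrite inE; apply/bigfcupP/orP => [[c]|[]/bigfcupP[c]].
- by rewrite andbT inE => /orP[] cS gc; [left|right];
    apply/bigfcupP; exists c; rewrite ?cS.
- by rewrite andbT => cS gc; exists c; rewrite // inE cS.
- by rewrite andbT => cS gc; exists c; rewrite // inE cS orbT.
Qed.

(* Greedy selection from the largest index down: a translate of lower index is
   rejected as soon as it meets a selected one, and temperedness bounds the
   number of centers lost in this way. *)
Lemma tempered_tiling (F : nat -> {fset G}) (C a : R) :
  (forall n, F n != fset0) ->
  (forall n, (0 < n)%N -> #|` (\bigcup_(j <- iota 0 n)
      [fset (h^-1 * g)%g | h in F j, g in F n])%fset |%:R <= C * #|` F n|%:R) ->
  0 <= C -> 0 < a < 1 ->
  forall n A k, {in A, forall g, k g < n}%N ->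
  exists S, [/\ (S `<=` A)%fset,
    (1 - a) * \sum_(c <- S) #|` F (k c)|%:R <= #|` tiling F k S|%:R &
    #|` A|%:R <= (a^-1 + C / (1 - a)) * #|` tiling F k S|%:R].
Proof.
move=> F0 Ftemp C0 a01; have /andP[a0 a1] := a01.
have b0 : 0 < 1 - a by rewrite subr_gt0.
elim=> [|n IH] A k kn.
  exists fset0; split; rewrite ?fsub0set// ?big_seq_fset0 ?mulr0//.
  have -> : A = fset0 by apply/eqP/fset0Pn => -[g /kn].
  by rewrite cardfs0 mulr_ge0// addr_ge0 ?invr_ge0 ?divr_ge0// ltW.
pose An := [fset g in A | k g == n]%fset.
have [Sn [SnA Sndisj Sncov]] := single_shape_tiling An (F0 n) a01.
set U := (\bigcup_(c <- Sn) _)%fset in Sndisj Sncov.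
(* Centers of lower index split into those whose translate avoids the top layer [U], passed to the
   induction, and the rejected ones, collected in [B]. *)
pose A' := [fset g in A | (k g < n)%N && [disjoint rtranslate (F (k g)) g & U]%fset]%fset.
pose B := [fset g in A | (k g < n)%N && ~~ [disjoint rtranslate (F (k g)) g & U]%fset]%fset.
have [g|S' [S'A S'disj S'cov]] := IH A' k; first by rewrite !inE /= => /and3P[].
have kSn c : c \in Sn -> k c = n.
  by move=> /(fsubsetP SnA); rewrite !inE /= => /andP[_ /eqP].
have tSn : tiling F k Sn = U.
  rewrite /tiling /U big_seq [RHS]big_seq; apply: eq_bigr => c /kSn ->//.
have tdisj : [disjoint tiling F k Sn & tiling F k S']%fset.
  rewrite tSn; apply/fdisjointP => g gU; apply/negP => /bigfcupP[c].
  rewrite andbT => /(fsubsetP S'A); rewrite !inE /= => /and3P[_ _].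
  by move=> /fdisjointP/[apply]; rewrite gU.
have Sdisj : [disjoint Sn & S']%fset.
  apply/fdisjointP => c /kSn cn; apply/negP => /(fsubsetP S'A).
  by rewrite !inE /= cn ltnn /= ?andbF.
have tcard : #|` tiling F k (Sn `|` S')%fset| = (#|` U| + #|` tiling F k S'|)%N.
  rewrite tilingU cardfsU tSn.
  by move: tdisj; rewrite tSn -fsetI_eq0 => /eqP ->; rewrite cardfs0 subn0.
exists (Sn `|` S')%fset; split.
- rewrite fsubUset (fsubset_trans SnA) ?(fsubset_trans S'A)//;
    by apply/fsubsetP => g; rewrite !inE /= => /andP[].
- rewrite tcard natrD (big_fsetID _ (mem Sn)) /=.
  have -> : [fset x in (Sn `|` S')%fset | x \in Sn]%fset = Sn.
    by apply/fsetP => c; rewrite !inE /=; case: (c \in Sn); rewrite ?andbF.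
  have -> : [fset x in (Sn `|` S')%fset | x \notin Sn]%fset = S'.
    apply/fsetP => c; rewrite !inE /=; have [cSn|cSn] := boolP (c \in Sn); last by rewrite andbT.
    by rewrite andbF; apply/esym/negbTE/(fdisjointP Sdisj).
  rewrite mulrDr lerD// (le_trans _ Sndisj)//.
  rewrite le_eqVlt; apply/orP; left; apply/eqP; congr (_ * _).
  rewrite natrM card_fset_sum1 natr_sum mulr_suml big_seq [RHS]big_seq.
  by apply: eq_bigr => c /kSn ->; rewrite mul1r.
- have AE : (A `<=` An `|` (B `|` A'))%fset.
    apply/fsubsetP => g gA; rewrite !inE /= gA /=.
    have := kn _ gA; rewrite ltnS leq_eqVlt => /orP[->//|->] /=.
    by rewrite ?orNb ?orbN ?orbT.
  have Ale : #|` A|%:R <= #|` An|%:R + #|` B|%:R + #|` A'|%:R :> R.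
    rewrite -!natrD ler_nat (leq_trans (fsubset_leq_card AE))// -addnA.
    rewrite (leq_trans (leq_card_fsetU _ _))// leq_add2l.
    exact: leq_card_fsetU.
  (* If F_(k g) g meets F_n c, then g lies in F_(k g)^-1 F_n c. So [B] is covered by [#|Sn|]
     translates of a set of at most C |F_n| points, and |Sn| |F_n| <= |U| / (1 - a). Temperedness
     says nothing at index 0, where [B] is empty. *)
  have Ble : #|` B|%:R <= C / (1 - a) * #|` U|%:R.
    have [n0|n0] := posnP n.
      have -> : B = fset0.
        by apply/fsetP => g; rewrite !inE /= n0 ltn0 /= ?andbF.
      by rewrite cardfs0 mulr_ge0// divr_ge0// ltW.
    pose D := (\bigcup_(j <- iota 0 n) [fset (h^-1 * g)%g | h in F j, g in F n])%fset.
    have BD : (B `<=` \bigcup_(c <- Sn) rtranslate D c)%fset.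
      apply/fsubsetP => g; rewrite !inE /= => /and3P[gA gn].
      rewrite -fsetI_eq0 => /fset0Pn[t]; rewrite inE in_rtranslate => /andP[tg].
      move=> /bigfcupP[c /[!andbT] cS]; rewrite in_rtranslate => tc.
      apply/bigfcupP; exists c; rewrite ?cS// in_rtranslate.
      apply/bigfcupP; exists (k g); first by rewrite mem_iota add0n leq0n gn.
      apply/imfset2P; exists (t * g^-1)%g => //; exists (t * c^-1)%g => //.
      by rewrite invgM invgK -!mulgA mulKg.
    have Bcard : #|` B|%:R <= #|` Sn|%:R * #|` D|%:R :> R.
      rewrite -natrM ler_nat (leq_trans (fsubset_leq_card BD))//.
      rewrite (leq_trans (card_bigfcup_le _ _))//.
      under eq_bigr do rewrite card_rtranslate.
      by rewrite big_const_seq count_predT iter_addn_0 mulnC.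
    rewrite (le_trans Bcard)// (le_trans (ler_wpM2l _ (Ftemp n n0)))//.
    rewrite mulrCA -mulrA ler_wpM2l// -natrM.
    by rewrite ler_pdivlMl.
  rewrite tcard natrD mulrDr (le_trans Ale)// lerD// mulrDl lerD//.
  by rewrite ler_pdivlMl.
Qed.

(** * Boundaries of finite sets and the effect of removing tiles *)

Definition boundary K D := [fset g in D | ~~ (rtranslate K g `<=` D)%fset]%fset.

Definition ltranslate g E := [fset (g * h)%g | h in E]%fset.

Lemma in_ltranslate g E h : (h \in ltranslate g E) = ((g^-1 * h)%g \in E).
Proof.
apply/imfsetP/idP => [[t /= tE ->]|gE]; first by rewrite mulKg.
by exists (g^-1 * h)%g => //; rewrite mulVKg.
Qed.

Lemma card_ltranslate g E : #|` ltranslate g E| = #|` E|.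
Proof. by rewrite card_imfset//=; exact: mulgI. Qed.

(** This counts the pairs (q, h) with q in [K], [h] outside [E] and q h in [E]: they account for the
    boundary points created when [E] is removed as a tile. Summing over [q] makes it easy to bound
    for Folner sets. *)
Definition defect K E := (\sum_(q <- K) #|` ltranslate q^-1 E `\` E|%fset)%N.

Lemma boundary_mono K K' D : (K `<=` K')%fset ->
  (#|` boundary K D| <= #|` boundary K' D|)%N.
Proof.
move=> KK; apply: fsubset_leq_card; apply/fsubsetP => g.
rewrite !inE /= => /andP[-> /=]; apply: contra => /fsubsetP K'D.
apply/fsubsetP => h; rewrite in_rtranslate => /(fsubsetP KK) hK.
by apply: K'D; rewrite in_rtranslate.
Qed.

(** A boundary point lies in D \ q^-1 D for some [q] in [K], and this set has as many points as q^-1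
    D \ D because D and q^-1 D have equal cardinality. *)
Lemma boundary_le_defect K D : (#|` boundary K D| <= defect K D)%N.
Proof.
have sub : (boundary K D `<=`
    \bigcup_(q <- K) (D `\` ltranslate q^-1 D))%fset.
  apply/fsubsetP => g; rewrite !inE /= => /andP[gD /fsubsetPn[h]].
  rewrite in_rtranslate => hK hD; apply/bigfcupP; exists (h * g^-1)%g.
    by rewrite hK.
  by rewrite inE in_ltranslate invgK mulgVK hD.
rewrite (leq_trans (fsubset_leq_card sub))// (leq_trans (card_bigfcup_le _ _))//.
by apply: leq_sum => q _; rewrite !cardfsD card_ltranslate fsetIC.
Qed.

(** If some q g leaves D \ T, it either leaves [D] or enters a tile that does not contain g; in the
    second case (q, g c^-1) is counted in the defect of that tile. *)
Lemma boundary_setD_tiling K D F k S :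
  (#|` boundary K (D `\` tiling F k S)%fset| <=
    #|` boundary K D| + \sum_(c <- S) defect K (F (k c)))%N.
Proof.
set T := tiling F k S.
pose W := (\bigcup_(c <- S) \bigcup_(q <- K)
  rtranslate (ltranslate q^-1 (F (k c)) `\` F (k c)) c)%fset.
have sub : (boundary K (D `\` T) `<=` boundary K D `|` W)%fset.
  apply/fsubsetP => g; rewrite !inE /= => /andP[/andP[gT gD] /fsubsetPn[h hK]].
  rewrite gD /= => hDT; have [hD|hD] := boolP (h \in D); last first.
    by apply/orP; left; apply/fsubsetPn; exists h.
  apply/orP; right; move: hDT; rewrite inE hD andbT negbK => /bigfcupP[c].
  rewrite andbT => cS hc; apply/bigfcupP; exists c; rewrite ?cS//.
  apply/bigfcupP; exists (h * g^-1)%g; first by rewrite -in_rtranslate hK.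
  rewrite in_rtranslate inE in_ltranslate invgK; apply/andP; split.
    apply: contra gT => gc; apply/bigfcupP; exists c; rewrite ?cS//.
    by rewrite in_rtranslate.
  by rewrite mulgA mulgVK -in_rtranslate.
rewrite (leq_trans (fsubset_leq_card sub))// (leq_trans (leq_card_fsetU _ _))//.
rewrite leq_add2l (leq_trans (card_bigfcup_le _ _))//; apply: leq_sum => c _.
rewrite (leq_trans (card_bigfcup_le _ _))//; apply: leq_sum => q _.
by rewrite card_rtranslate.
Qed.

Lemma near_seq_in (T : eqType) (U : Type) (H : set_system U) (s : seq T)
    (P : T -> U -> Prop) {FH : Filter H} :
  (forall q, q \in s -> \forall n \near H, P q n) ->
  \forall n \near H, forall q, q \in s -> P q n.
Proof.
elim: s => [|q s IH] HP; first by near=> n => q; rewrite in_nil.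
near=> n => q'; rewrite inE => /orP[/eqP ->|].
  by near: n; apply: HP; rewrite mem_head.
by move: q'; near: n; apply: IH => q' q's; apply: HP; rewrite inE q's orbT.
Unshelve. all: by end_near. Qed.

Lemma folner_defect F K (eta : R) : folner R F -> 0 < eta ->
  \forall n \near \oo, (defect K (F n))%:R <= eta * #|` F n|%:R.
Proof.
move=> [F0 Flim] eta0.
pose eta' := eta / (#|` K|%:R + 1).
have eta'0 : 0 < eta' by rewrite divr_gt0// ltr_wpDl.
have nearq q : \forall n \near \oo,
    #|` ltranslate q^-1 (F n) `\` F n|%fset%:R <= eta' * #|` F n|%:R :> R.
  have /cvgrPdist_le/(_ _ eta'0) := Flim q^-1%g.
  apply: filterS => n /=; rewrite -/(ltranslate _ _).
  set f := #|` F n|%:R; set i := #|` _|%:R.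
  have f0 : 0 < f by rewrite ltr0n cardfs_gt0.
  have -> : #|` ltranslate q^-1 (F n) `\` F n|%fset%:R = f - i :> R.
    rewrite cardfsD card_ltranslate fsetIC natrB//.
    by rewrite fsubset_leq_card// fsubsetIl.
  move=> /(le_trans (ler_norm _)).
  move=> le_eta; rewrite -ler_pdivrMr// mulrBl divff ?gt_eqF//.
apply: filterS (near_seq_in (fun q (_ : q \in enum_fset K) => nearq q)) => n nq.
rewrite natr_sum big_seq (le_trans (ler_sum _ nq))// -big_seq.
rewrite big_const_seq count_predT iter_addr_0 -mulrnAl ler_wpM2r// -mulr_natr.
by rewrite /eta' mulrAC ler_pdivrMr ?ltr_wpDl// ler_wpM2l ?(ltW eta0)// lerDl.
Qed.

End GroupCovering.

(** * Local covers of the sets Gamma *)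

Lemma bigmax_seq_leP (R : realType) (T : eqType) (s : seq T) (f : T -> R) r :
  0 <= r ->
  \big[Num.max/0]_(i <- s) f i <= r <-> {in s, forall i, f i <= r}.
Proof.
move=> r0; elim: s => [|h s IH]; first by rewrite big_nil; split.
rewrite big_cons ge_max; split => [/andP[hr /IH sr] g|sr].
  by rewrite inE => /orP[/eqP->//|/sr].
apply/andP; split; first by apply: sr; rewrite mem_head.
by apply/IH => g gs; apply: sr; rewrite inE gs orbT.
Qed.

Lemma bigmax_seq_ltP (R : realType) (T : eqType) (s : seq T) (f : T -> R) r :
  0 < r ->
  \big[Num.max/0]_(i <- s) f i < r <-> {in s, forall i, f i < r}.
Proof.
move=> r0; elim: s => [|h s IH]; first by rewrite big_nil; split.
rewrite big_cons gt_max; split => [/andP[hr /IH sr] g|sr].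
  by rewrite inE => /orP[/eqP->//|/sr].
apply/andP; split; first by apply: sr; rewrite mem_head.
by apply/IH => g gs; apply: sr; rewrite inE gs orbT.
Qed.

(** Under this filter, eventually means for every sufficiently large finite set. It lets
    near-covering compactness produce a finite subset of the group in the same way as a large
    integer. *)
Definition fset_filter (T : choiceType) : set_system {fset T} :=
  filter_from setT (fun K => [set K' | (K `<=` K')%fset]).

#[global] Instance fset_filter_proper (T : choiceType) :
  ProperFilter (@fset_filter T).
Proof.
apply: filter_from_proper; last by move=> K _; exists K => /=.
apply: filter_from_filter; first by exists fset0.
move=> K L _ _; exists (K `|` L)%fset => // M /=.
by rewrite fsubUset => /andP.
Qed.

Arguments fset_filter {T}.

Section Dynamics.
Context (R : realType) (G : groupType) (X : metricType R) (act : G -> X -> X).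
Implicit Types (E K : {fset G}) (x y z : X) (r e : R).

Lemma dynamical_dist_leP E x y r : 0 <= r ->
  dynamical_dist act E x y <= r <->
  forall g, g \in E -> mdist (act g x) (act g y) <= r.
Proof. by move=> r0; apply: bigmax_seq_leP. Qed.

Lemma dynamical_dist_ltP E x y r : 0 < r ->
  dynamical_dist act E x y < r <->
  forall g, g \in E -> mdist (act g x) (act g y) < r.
Proof. by move=> r0; apply: bigmax_seq_ltP. Qed.

Lemma dynamical_dist_gtP E x y r : 0 <= r ->
  r < dynamical_dist act E x y <->
  exists2 g, g \in E & r < mdist (act g x) (act g y).
Proof.
move=> r0; split => [|[g gE rg]]; last first.
  by rewrite ltNge; apply/negP => /(dynamical_dist_leP _ _ _ r0)/(_ g gE);
    rewrite leNgt rg.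
apply: contraPP => nex; apply/negP; rewrite -leNgt.
apply/dynamical_dist_leP => // g gE; rewrite leNgt; apply/negP => rg.
by apply: nex; exists g.
Qed.

Hypothesis actP : continuous_action act.

Lemma near_mdist_act g x r : 0 < r ->
  \forall x' \near x, mdist (act g x) (act g x') < r.
Proof.
have [_ _ cont] := actP => r0.
exact: metricType_numDomainType.cvgr_dist_lt (cont g x) _ r0.
Qed.

Lemma near_oball E r x y : 0 < r -> dynamical_oball act E r x y ->
  \forall y' \near y, dynamical_oball act E r x y'.
Proof.
move=> r0 /(dynamical_dist_ltP _ _ _ r0) xy.
suff : \forall y' \near y, forall g, g \in enum_fset E ->
    mdist (act g x) (act g y') < r.
  by apply: filterS => y' xy'; apply/(dynamical_dist_ltP _ _ _ r0).
apply: (near_seq_in (P := fun g y' => mdist (act g x) (act g y') < r)) => g gE.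
have gxy : 0 < r - mdist (act g x) (act g y) by rewrite subr_gt0 xy.
apply: filterS (near_mdist_act g y gxy) => y' yy'.
by rewrite (le_lt_trans (metric_triangle _ (act g y) _))// -ltrBrDl.
Qed.

Lemma near_gt_mdist_act g e x y : e < mdist (act g x) (act g y) ->
  \forall y' \near y & x' \near x, e < mdist (act g x') (act g y').
Proof.
rewrite -subr_gt0 => e0; set r := _ - e in e0.
have r2 : 0 < r / 2 by rewrite divr_gt0.
near=> y' x'.
have xx' : mdist (act g x) (act g x') < r / 2.
  by near: x'; exact: near_mdist_act.
have yy' : mdist (act g y) (act g y') < r / 2.
  by near: y'; exact: near_mdist_act.
have := metric_triangle (act g x) (act g x') (act g y).
have := metric_triangle (act g x') (act g y') (act g y).
rewrite (metric_sym (act g y') (act g y)); rewrite /r in xx' yy'.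
lra.
Unshelve. all: by end_near. Qed.

Hypothesis Xcompact : compact [set: X].

(** A point [y] either lies in [Gamma act e x], hence in one of the open balls, or satisfies d(gx,
    gy) > e for some g. Both alternatives persist for nearby [y], and the second for nearby [x'] as
    well, so compactness in [y] leaves finitely many balls and finitely many g. *)
Lemma Gamma_cover_near (I : set nat) (k : nat -> nat) (c : nat -> X)
    (F : nat -> {fset G}) (e delta : R) x : 0 < delta ->
  Gamma act e x `<=` \bigcup_(i in I) dynamical_oball act (F (k i)) delta (c i) ->
  exists n K, \forall x' \near x, forall y,
    (forall g, g \in K -> mdist (act g x') (act g y) <= e) ->
    exists i, [/\ (i < n)%N, I i & dynamical_oball act (F (k i)) delta (c i) y].
Proof.
move=> delta0 cov.
pose P (p : nat * {fset G} * X) y := (exists i, [/\ (i < p.1.1)%N, I i &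
    dynamical_oball act (F (k i)) delta (c i) y]) \/
  exists2 g, g \in p.1.2 & e < mdist (act g p.2) (act g y).
have /compact_near_coveringP/(_ _ (filter_prod (filter_prod \oo fset_filter) (nbhs x)) P) := Xcompact.
case=> [y _|[A B] /= [[[A1 A2] /= [A1n [K _ KA2]] A12] Bx] AB].
  have [yG|] := pselect (Gamma act e x y).
    have [i Ii yi] := cov _ yG.
    exists (dynamical_oball act (F (k i)) delta (c i), [set p | (i < p.1.1)%N]) => /=.
      split; first exact: near_oball.
      exists ([set p | (i < p.1)%N], setT) => /=; last by move=> [[]] ? ? ? [].
      split; last exact: filterT.
      exists ([set n | (i < n)%N], setT) => /=; last by move=> [] ? ? [].
      by split; [exists i.+1|exact: filterT].
    by move=> [y' p] /= [yi' ip]; left; exists i.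
  move=> /existsNP[g /negP]; rewrite -ltNge => /near_gt_mdist_act.
  move=> [[V W] /= [Vy Wx] VW].
  exists (V, [set p | g \in p.1.2 /\ W p.2]) => /=.
    split=> //; exists ([set p | g \in p.2], W) => /=; last by move=> [[]].
    split=> //; exists (setT, [set K | g \in K]) => /=; last by move=> [] ? ? [].
    split; first exact: filterT.
    by exists [fset g]%fset => // K /=; rewrite fsub1set.
  move=> [y' p] /= [Vy' [gp Wp]]; right; exists g => //.
  exact: (VW (y', p.2)).
have [n A1n'] : exists n, A1 n by case: A1n => n _ /(_ n (leqnn n)); exists n.
exists n, K; apply: filterS Bx => x' Bx' y yK.
have [//|[g gK]] := AB ((n, K), x') (conj (A12 (n, K) (conj A1n' (KA2 _ (fsubset_refl K)))) Bx') y Logic.I.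
by rewrite ltNge yK.
Qed.

End Dynamics.

(** * Bowen covers with bounds uniform in the base point *)

Section BowenCover.
Context (R : realType) (G : groupType) (X : metricType R) (act : G -> X -> X).
Variable F : nat -> {fset G}.
Implicit Types (Z : set X) (lambda eps delta : R).

Lemma bowen_pre_ge0 lambda eps delta Z : (0 <= bowen_pre act F lambda eps delta Z)%E.
Proof.
apply: le_ereal_inf_tmp => _ [I [k [c [_ ->]]]].
by apply: esum_ge0 => i _; rewrite lee_fin expR_ge0.
Qed.

Lemma bowen_limE lambda delta Z : bowen_lim act F lambda delta Z =
  ereal_sup [set bowen_pre act F lambda eps delta Z | eps in [set eps | 0 < eps]].
Proof.
rewrite /bowen_lim.
rewrite (_ : [set eps | 0 < eps] = [set` `]0, +oo[%R]); last first.
  by apply/seteqP; split => x /=; rewrite in_itv/= andbT.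
apply/cvg_lim => //; apply: nonincreasing_at_right_cvge => //.
move=> s t; rewrite !in_itv/= !andbT => s0 t0 st.
apply: ereal_inf_le_tmp => _ [I [k [c [[Ik cov] ->]]]]; exists I, k, c; split => //.
by split => // i Ii; rewrite (le_trans _ (Ik i Ii))// lef_pV2.
Qed.

Lemma htopB_lt_cover lambda delta Z : (htopB act F Z delta < lambda%:E)%E ->
  forall eps eta, 0 < eps -> 0 < eta -> exists I k c,
    covering act F eps delta Z I k c /\ (family_sum F lambda I k < eta%:E)%E.
Proof.
move=> /ereal_inf_lt[_ [l [l0 lim0] <-]]; rewrite lte_fin => llambda eps eta eps0 eta0.
have : (bowen_pre act F l eps delta Z < eta%:E)%E.
  rewrite (@le_lt_trans _ _ 0%E)// -lim0 bowen_limE.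
  by apply: ereal_sup_ubound; exists eps.
move=> /ereal_inf_lt[_ [I [k [c [cov ->]]]] Ieta].
exists I, k, c; split => //; rewrite (le_lt_trans _ Ieta)//.
apply: le_esum => i _; rewrite lee_fin ler_expR lerN2.
by rewrite ler_wpM2r// ltW.
Qed.

Hypothesis actP : continuous_action act.
Hypothesis Xcompact : compact [set: X].

(** Compactness is used again, now in [x]: a cover found at [x] serves all nearby points, so common
    [b] and [K] exist. The labels [i] are bounded by [b] too, since they become letters of a finite
    code. *)
Lemma uniform_local_cover lambda delta e : 0 < delta ->
  (forall x, htopB act F (Gamma act e x) delta < lambda%:E)%E ->
  forall (eta : R) k0, 0 < eta -> exists b (K : {fset G}), forall x,
  exists (I : {fset nat}) (k : nat -> nat) (c : nat -> X), [/\
    forall i, i \in I -> (i < b)%N /\ (k0 <= k i < b)%N,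
    \sum_(i <- I) expR (- (lambda * #|` F (k i)|%:R)) <= eta &
    forall y, (forall g, g \in K -> mdist (act g x) (act g y) <= e) ->
      exists2 i, i \in I & dynamical_oball act (F (k i)) delta (c i) y].
Proof.
move=> delta0 hB eta k0 eta0.
pose P (p : nat * {fset G}) x := exists (I : {fset nat}) (k : nat -> nat) (c : nat -> X), [/\
    forall i, i \in I -> (i < p.1)%N /\ (k0 <= k i < p.1)%N,
    \sum_(i <- I) expR (- (lambda * #|` F (k i)|%:R)) <= eta &
    forall y, (forall g, g \in p.2 -> mdist (act g x) (act g y) <= e) ->
      exists2 i, i \in I & dynamical_oball act (F (k i)) delta (c i) y].
suff [[A1 A2] /= [[n _ An] [K _ KA] A12]] :
    filter_prod \oo fset_filter (fun p => [set: X] `<=` P p).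
  exists n, K => x; apply: (A12 (n, K)) => //.
  by split; [apply: An => /= | apply: KA => /=].
have /compact_near_coveringP/(_ _ (filter_prod \oo fset_filter) P) := Xcompact.
apply=> x _.
(* Shapes with at least [N] elements cannot be F_j with j < k0, whence [k0 <= k i]. *)
pose N := (\max_(j < k0) #|` F j|).+1.
have N0 : 0 < N%:R^-1 :> R by rewrite invr_gt0 ltr0n.
have [I [k [c [[Ik cov] Isum]]]] := htopB_lt_cover (hB x) N0 eta0.
have [n [K nK]] := Gamma_cover_near actP Xcompact delta0 cov.
pose J := [fset i in iota 0 n | `[< I i >]]%fset.
have JP i : i \in J <-> (i < n)%N /\ I i.
  rewrite !inE /= mem_iota add0n leq0n /=.
  by split => [/andP[? /asboolP]|[-> /asboolP]].
pose b := (n + \max_(i < n) (k i).+1)%N.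
exists ([set x' | forall y, (forall g, g \in K -> mdist (act g x') (act g y) <= e) ->
   exists i, [/\ (i < n)%N, I i & dynamical_oball act (F (k i)) delta (c i) y]],
  [set p | (b <= p.1)%N /\ (K `<=` p.2)%fset]) => /=.
  split => //; exists ([set m | (b <= m)%N], [set K' | (K `<=` K')%fset]) => //=.
  by split; [exists b|exists K].
move=> [x' [m K']] /= [x'K [bm KK']]; exists J, k, c; split => /=.
- move=> i /JP[iltn Ii]; split.
    by rewrite (leq_trans iltn)// (leq_trans _ bm)// leq_addr.
  apply/andP; split.
    rewrite leqNgt; apply/negP => ki.
    have := Ik i Ii; rewrite invrK ler_nat ltnNge.
    by rewrite -ltnS ltnS (leq_bigmax (Ordinal ki)).
  rewrite (leq_trans _ bm)// (leq_trans _ (leq_addl _ _))//.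
  exact: (leq_bigmax (F := fun i : 'I_n => (k i).+1) (Ordinal iltn)).
- rewrite -lee_fin (le_trans _ (ltW Isum))// /family_sum.
  apply: esum_ge; exists [set` J]; first by split => // i /JP[].
  by rewrite fsbig_finite//= set_fsetK sumEFin.
- move=> y yK'; have [|i [iltn Ii yi]] := x'K y.
    by move=> g gK; apply: yK'; exact: (fsubsetP KK').
  by exists i => //; apply/JP.
Qed.

End BowenCover.

(** * Improving entropy bounds *)

Lemma card_le_sum_fibers (R : realType) (X : choiceType) (T : finType)
    (H : {fset X}) (phi : X -> T) (w : T -> R) :
  (forall f, #|` [fset y in H | phi y == f]%fset|%:R <= w f) ->
  #|` H|%:R <= \sum_f w f.
Proof.
move=> Hw; apply: le_trans (ler_sum _ (fun f _ => Hw f)).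
under eq_bigr do rewrite card_fset_pred.
rewrite -natr_sum exchange_big /= card_fset_sum1 ler_nat; apply: leq_sum => y _.
by rewrite (bigD1 (phi y))//= eqxx.
Qed.

Lemma fset_card_le1 (T : choiceType) (A : {fset T}) :
  {in A &, forall y z, y = z} -> (#|` A| <= 1)%N.
Proof.
move=> AE; have [->|/fset0Pn[y yA]] := eqVneq A fset0; first by rewrite cardfs0.
rewrite -(cardfs1 y) fsubset_leq_card//; apply/fsubsetP => z zA.
by rewrite inE (AE _ _ zA yA).
Qed.

Lemma compact_finite_net (R : realType) (X : metricType R) (r : R) :
  compact [set: X] -> 0 < r ->
  exists S : {fset X}, forall y, exists2 s, s \in S & mdist s y < r.
Proof.
move=> Xcompact r0.
pose P (S : {fset X}) y := exists2 s, s \in S & mdist s y < r.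
suff [S _ HS] : fset_filter (fun S => [set: X] `<=` P S).
  by exists S => y; apply: HS => /=.
have /compact_near_coveringP/(_ _ fset_filter P) := Xcompact.
apply=> x _; exists (ball x r, [set S | x \in S]) => /=.
  split; first exact: nbhsx_ballx.
  by exists [fset x]%fset => // S /=; rewrite fsub1set.
by move=> [y S] /=; rewrite ballEmdist /= => -[xy xS]; exists x.
Qed.

Section Core.
Context (R : realType) (G : groupType) (X : metricType R) (act : G -> X -> X).
Implicit Types (D K : {fset G}) (x y : X) (H : {fset X}) (e r delta : R).

(** The code of [y] records, for each [g] in [D], a net point near gy. *)
Lemma finite_coding D (S : {fset X}) r : 0 < r ->
  (forall y, exists2 s, s \in S & mdist s y < r) ->
  exists phi : X -> {ffun D -> S}, forall y z, phi y = phi z ->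
    forall g, g \in D -> mdist (act g y) (act g z) < r + r.
Proof.
move=> r0 netS.
have /choice[f fP] : forall y, exists s : S, mdist (val s) y < r.
  by move=> y; have [s sS sy] := netS y; exists [` sS]%fset.
exists (fun y => [ffun g : D => f (act (val g) y)]) => y z /ffunP yz g gD.
have := yz [` gD]%fset; rewrite !ffunE /= => fyz.
rewrite (le_lt_trans (metric_triangle _ (val (f (act g y))) _))// ltrD//.
  by rewrite metric_sym.
by rewrite fyz.
Qed.

Lemma separated_card_le D (S : {fset X}) r H : 0 < r ->
  (forall y, exists2 s, s \in S & mdist s y < r / 2) ->
  fset_separated act D r H -> (#|` H| <= #|` S| ^ #|` D|)%N.
Proof.
move=> r0 netS sepH; have r2 : 0 < r / 2 by rewrite divr_gt0.
have [phi phiP] := finite_coding D r2 netS.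
rewrite -(ler_nat R); apply: (@le_trans _ _ (\sum_(f : {ffun D -> S}) 1)).
  apply: (card_le_sum_fibers (phi := phi)) => f.
  rewrite lern1; apply: fset_card_le1 => y z.
  rewrite !inE /= => /andP[yH /eqP fy] /andP[zH /eqP fz].
  apply/eqP/negPn/negP => yz.
  have := sepH y z yH zH yz; rewrite ltNge => /negP; apply.
  apply/dynamical_dist_leP; first exact: ltW.
  by move=> g gD; rewrite [leRHS]splitr ltW// (phiP y z)// fy.
by rewrite sumr_const card_ffun -!cardfE.
Qed.

(* The boundary term replaces an invariance hypothesis on [D], so that the bound
   also applies to what is left of [D] once tiles have been removed. *)
Definition entropy_bound e r (h : R) := exists K (M : R), 0 <= M /\
  forall D x H,
    (forall y, y \in H -> forall g, g \in D -> mdist (act g x) (act g y) <= e) ->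
    fset_separated act D r H ->
    #|` H|%:R <= expR (h * #|` D|%:R + M * #|` boundary K D|%:R).

(** This starts the descent on [h]. Separated points have distinct codes, and |S| <= exp |S| makes
    |S| a sufficient, if crude, exponent. *)
Lemma entropy_bound_trivial e r : compact [set: X] -> 0 < r ->
  exists h, entropy_bound e r h.
Proof.
move=> Xcompact r0; have r2 : 0 < r / 2 by rewrite divr_gt0.
have [S netS] := compact_finite_net Xcompact r2.
exists (#|` S|%:R); exists fset0, 0; split => // D x H _ sepH.
have := separated_card_le r0 netS sepH; rewrite -(ler_nat R) => /le_trans; apply.
rewrite mul0r addr0 natrX expRM_natr.
apply: lerXn2r; rewrite ?nnegrE ?expR_ge0//.
by rewrite (le_trans _ (expR_ge1Dx _))// lerDr.
Qed.

Lemma fset_separatedD D T r H : 0 <= r -> fset_separated act D r H ->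
  {in H &, forall y z, forall t, t \in T -> mdist (act t y) (act t z) <= r} ->
  fset_separated act (D `\` T)%fset r H.
Proof.
move=> r0 sepH HT y z yH zH yz.
have /(dynamical_dist_gtP _ _ _ _ r0)[g gD rg] := sepH y z yH zH yz.
apply/dynamical_dist_gtP => //; exists g => //; rewrite inE gD andbT.
by apply/negP => gT; have := HT y z yH zH g gT; rewrite leNgt rg.
Qed.

(** The weight of a code is a product over all possible centers; unselected ones contribute 1, so
    only the tiles that are used appear in the exponent. *)
Lemma weight_prod (A S : {fset G}) (b : nat) (w : G -> 'I_b -> R) (f : A -> option 'I_b)
    (v : G -> R) : (S `<=` A)%fset ->
  (forall g : A, val g \notin S -> f g = None) ->
  (forall g : A, val g \in S -> exists2 j, f g = Some j & w (val g) j = expR (- v (val g))) ->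
  \prod_(g : A) (if f g is Some j then w (val g) j else 1) = expR (- \sum_(c <- S) v c).
Proof.
move=> SA fN fS; pose u g := if g \in S then expR (- v g) else 1.
transitivity (\prod_(g : A) u (val g)).
  apply: eq_bigr => g _; rewrite /u; have [gS|gS] := boolP (val g \in S).
    by have [j -> ->] := fS g gS.
  by rewrite fN.
rewrite -(big_seq_fsetE _ _ predT u) -(big_fset_incl _ SA) /=.
  rewrite -sumrN expR_sum big_seq [RHS]big_seq.
  by apply: eq_bigr => c cS; rewrite /u cS.
by move=> g _ gS; rewrite /u (negbTE gS).
Qed.

(** All choices at one center, including not selecting it, weigh 1 plus the weight of the local
    cover; this will be at most 1 + eta <= exp eta. *)
Lemma weight_sum (I : {fset nat}) (b : nat) (v : nat -> R) :
  (forall i, i \in I -> (i < b)%N) ->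
  \sum_(o : option 'I_b)
    (if o is Some j then (if (j : nat) \in I then v j else 0) else 1) =
  1 + \sum_(i <- I) v i.
Proof.
move=> Ib; rewrite (bigD1 None)//=; congr (_ + _).
rewrite (reindex_omap Some id) /=; last by case.
under eq_bigl do rewrite eqxx.
rewrite -big_mkcond /= -(big_mkord (fun j => j \in I)) -big_filter.
apply: perm_big; apply: uniq_perm; rewrite ?filter_uniq ?iota_uniq ?fset_uniq//.
move=> i; rewrite mem_filter mem_index_iota leq0n /=.
by case: (boolP (i \in I)) => // /Ib ->.
Qed.

(** The arithmetic of one improvement, with d = |D|, t the size of the tiled part, beta the boundary
    of [D], s the sum of the tile sizes, and q, q' the size and boundary of the untiled part.
    Trading h for l / (1 - a) on the tiles gains 4 eta d, up to a multiple of beta: 2 eta d is kept,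
    eta d absorbs the boundaries of the tiles, and eta d is reserved for the choice of code. The
    factor 1 / (1 - a) pays for overlaps. *)
Lemma improve_exponent (h l a kappa eta eta' M0 d t beta s q q' : R) :
  0 <= M0 -> 0 < eta -> 0 <= s -> 0 < a < 1 -> l / (1 - a) < h -> 0 <= h ->
  0 <= l ->
  4 * eta = kappa * (h - l / (1 - a)) ->
  M0 * eta' <= eta * (1 - a) ->
  (1 - a) * s <= t -> t <= d -> kappa * (d - beta) <= t ->
  q <= d - t -> q' <= beta + eta' * s ->
  h * q + M0 * q' <= (h - kappa * (h - l / (1 - a)) / 2) * d +
    (M0 + kappa * (h - l / (1 - a))) * beta - l * s - eta * d.
Proof.
move=> M00 eta0 s0 /andP[a0 a1] lh h0 l0 etaE Meta st td kt qd q'b.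
have b0 : 0 < 1 - a by rewrite subr_gt0.
set l' := l / (1 - a) in lh etaE *.
have lE : l = l' * (1 - a) by rewrite /l' divfK// gt_eqF.
have l'0 : 0 <= l' by rewrite divr_ge0// ltW.
have h1 : h * q <= h * (d - t) by rewrite ler_wpM2l.
have h2 : M0 * q' <= M0 * beta + M0 * eta' * s.
  by rewrite -mulrA -mulrDr ler_wpM2l.
have h3 : l * s <= l' * t by rewrite lE -mulrA ler_wpM2l.
have h4 : M0 * eta' * s <= eta * d.
  apply: (@le_trans _ _ (eta * ((1 - a) * s))).
    by rewrite mulrA ler_wpM2r.
  by rewrite ler_wpM2l ?(ltW eta0)// (le_trans st).
have h5 : (h - l') * (kappa * (d - beta)) <= (h - l') * t.
  by rewrite ler_wpM2l// subr_ge0 ltW.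
have h6 : (h - l') * (kappa * (d - beta)) = 4 * eta * d - 4 * eta * beta.
  by rewrite mulrA [X in X * _]mulrC -etaE; lra.
have -> : (h - kappa * (h - l') / 2) * d + (M0 + kappa * (h - l')) * beta =
    h * d - 2 * eta * d + M0 * beta + 4 * eta * beta.
  by rewrite -etaE; lra.
rewrite h6 in h5; rewrite mulrBl in h5; rewrite mulrBr in h1.
lra.
Qed.

Lemma entropy_bound_improve (F : nat -> {fset G}) (C a lambda delta e h : R) :
  continuous_action act -> compact [set: X] -> folner R F ->
  (forall n, (0 < n)%N -> #|` (\bigcup_(j <- iota 0 n)
      [fset (h^-1 * g)%g | h in F j, g in F n])%fset |%:R <= C * #|` F n|%:R) ->
  0 <= C -> 0 < a < 1 -> 0 < delta -> 0 <= lambda ->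
  (forall x, htopB act F (Gamma act e x) delta < lambda%:E)%E ->
  lambda / (1 - a) < h -> entropy_bound e (delta + delta) h ->
  entropy_bound e (delta + delta)
    (h - (a^-1 + C / (1 - a))^-1 * (h - lambda / (1 - a)) / 2).
Proof.
move=> actP Xcompact folnerF temperedF C0 a01 delta0 lambda0 hB lh.
move=> [K0 [M0 [M00 boundK0]]]; have /andP[a0 a1] := a01.
have b0 : 0 < 1 - a by rewrite subr_gt0.
have F0 := folnerF.1.
have [_ actM _] := actP.
set kappa := (_ + _)^-1; set l' := lambda / (1 - a).
have kappa0 : 0 < kappa by rewrite invr_gt0 ltr_pwDl ?invr_gt0// divr_ge0// ltW.
have h0 : 0 <= h by rewrite (le_trans _ (ltW lh))// divr_ge0// ltW.
pose eta := kappa * (h - l') / 4.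
have eta0 : 0 < eta by rewrite divr_gt0// mulr_gt0// subr_gt0.
pose eta' := eta * (1 - a) / (M0 + 1).
have M01 : 0 < M0 + 1 by rewrite ltr_wpDl.
have eta'0 : 0 < eta' by rewrite divr_gt0// mulr_gt0.
have Meta : M0 * eta' <= eta * (1 - a).
  rewrite /eta' mulrA ler_pdivrMr// mulrC ler_wpM2l ?lerDl//.
  by rewrite ltW// mulr_gt0.
have [k0 _ k0P] := folner_defect K0 folnerF eta'0.
have [b [K1 /choice[I_ /choice[k_ /choice[c_ localP]]]]] :=
  uniform_local_cover actP Xcompact delta0 hB k0 eta0.
(* [K0] serves the old bound, [K1] makes the local cover at gx applicable to gy, and the sets F_j
   keep the tiles inside [D]. *)
pose K := (K0 `|` (K1 `|` \bigcup_(j <- iota 0 b) F j))%fset.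
exists K, (M0 + kappa * (h - l')); split.
  by rewrite addr_ge0// mulr_ge0 ?(ltW kappa0)// subr_ge0 ltW.
move=> D x H HD sepH.
pose A := (D `\` boundary K D)%fset.
have AP g q : g \in A -> q \in K -> (q * g)%g \in D.
  move=> gA qK; move: gA; rewrite inE => /andP[+ gD].
  rewrite !inE /= gD /= negbK => /fsubsetP; apply.
  by rewrite in_rtranslate mulgK.
have AD : (A `<=` D)%fset by exact: fsubsetDl.
(* [i_ y g] labels a ball attached to gx that contains gy; the value 0 elsewhere is a dummy. *)
have /choice[i_ iP] : forall y, exists i : G -> nat, y \in H -> forall g, g \in A ->
    i g \in I_ (act g x) /\
    dynamical_oball act (F (k_ (act g x) (i g))) delta (c_ (act g x) (i g)) (act g y).
  move=> y; have [yH|yH] := boolP (y \in H); last by exists (fun=> 0%N).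
  suff /choice[i iP] : forall g, exists i : nat, g \in A -> i \in I_ (act g x) /\
      dynamical_oball act (F (k_ (act g x) i)) delta (c_ (act g x) i) (act g y).
    by exists i => _ g; exact: iP.
  move=> g; have [gA|gA] := boolP (g \in A); last by exists 0%N.
  have [_ _ /(_ (act g y))[q qK1|i iI yi]] := localP (act g x); last by exists i.
  by rewrite -!actM; apply: HD => //; apply: AP; rewrite // !inE qK1 orbT.
pose ky y g := k_ (act g x) (i_ y g).
have kyP y g : y \in H -> g \in A -> (k0 <= ky y g < b)%N.
  move=> yH gA; have [iI _] := iP y yH g gA.
  by have [/(_ _ iI)[_ +] _ _] := localP (act g x).
have iyP y g : y \in H -> g \in A -> (i_ y g < b)%N.
  move=> yH gA; have [iI _] := iP y yH g gA.
  by have [/(_ _ iI)[+ _] _ _] := localP (act g x).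
have /choice[S SP] : forall y, exists S, y \in H -> [/\ (S `<=` A)%fset,
    (1 - a) * \sum_(c <- S) #|` F (ky y c)|%:R <= #|` tiling F (ky y) S|%:R &
    #|` A|%:R <= (a^-1 + C / (1 - a)) * #|` tiling F (ky y) S|%:R].
  move=> y; have [yH|yH] := boolP (y \in H); last by exists fset0.
  have [|S SP] := tempered_tiling F0 temperedF C0 a01 (n := b) (A := A) (k := ky y).
    by move=> g gA; have /andP[] := kyP y g yH gA.
  by exists S.
(* The code shows the selected centers, as the places different from [None], together with the balls
   chosen there. *)
pose phi y : {ffun A -> option 'I_b} :=
  [ffun g => if val g \in S y then insub (i_ y (val g)) else None].
pose v g i : R := expR (- (lambda * #|` F (k_ (act g x) i)|%:R)).
pose w g (o : option 'I_b) : R :=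
  if o is Some j then if (j : nat) \in I_ (act g x) then v g j else 0 else 1.
pose d : R := #|` D|%:R; pose beta : R := #|` boundary K D|%:R.
pose Q : R := expR ((h - kappa * (h - l') / 2) * d +
  (M0 + kappa * (h - l')) * beta - eta * d).
(* Summed over all codes, the products of weights factor into a product over centers of sums at most
   exp eta; the total exp (eta d) cancels the reserve in [Q]. *)
suff fiber f : #|` [fset y in H | phi y == f]%fset|%:R <=
    Q * \prod_(g : A) w (val g) (f g).
  apply: le_trans (card_le_sum_fibers fiber) _.
  rewrite -mulr_sumr -(bigA_distr_bigA (fun (g : A) o => w (val g) o)) /=.
  apply: (@le_trans _ _ (Q * expR (eta * d))); last by rewrite -expRD subrK.
  rewrite ler_wpM2l ?expR_ge0//.
  apply: (@le_trans _ _ (\prod_(g : A) expR eta)).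
    apply: ler_prod => g _; apply/andP; split.
      apply: sumr_ge0 => -[j _|//]; rewrite /w; case: ifP => // _.
      exact: expR_ge0.
    have [Ib Isum _] := localP (act (val g) x).
    rewrite /w weight_sum; last by move=> i /Ib[].
    by rewrite (le_trans _ (expR_ge1Dx _))// lerD2l.
  rewrite prodr_const -cardfE -expRM_natr ler_expR ler_wpM2l ?(ltW eta0)//.
  by rewrite ler_nat fsubset_leq_card.
(* A nonempty fiber has a representative [y0], whose tiling serves for the whole fiber. *)
have [->|/fset0Pn[y0]] := eqVneq [fset y in H | phi y == f]%fset fset0.
  rewrite cardfs0 mulr_ge0 ?expR_ge0//; apply: prodr_ge0 => g _.
  by rewrite /w; case: (f g) => // j; case: ifP => // _; exact: expR_ge0.
rewrite !inE /= => /andP[y0H /eqP fE]; subst f.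
have [SA Sdisj Scov] := SP y0 y0H.
set T := tiling F (ky y0) (S y0) in Sdisj Scov.
have TD : (T `<=` D)%fset.
  apply/fsubsetP => t /bigfcupP[c]; rewrite andbT in_rtranslate => cS tc.
  have cA := fsubsetP SA _ cS.
  rewrite -(mulgVK c t); apply: AP => //; rewrite !inE; apply/orP; right.
  apply/orP; right; apply/bigfcupP; exists (ky y0 c) => //.
  by rewrite mem_iota andbT add0n leq0n /=; have /andP[] := kyP y0 c y0H cA.
have phiS y c : y \in H -> phi y = phi y0 -> c \in S y0 -> i_ y c = i_ y0 c.
  move=> yH yy0 cS; have cA := fsubsetP SA _ cS.
  have /ffunP/(_ [` cA]%fset) := yy0; rewrite !ffunE /= cS.
  rewrite (insubT (fun i => (i < b)%N) (iyP y0 c y0H cA)).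
  case: ifP => // _; rewrite (insubT (fun i => (i < b)%N) (iyP y c yH cA)).
  by case.
set H' := [fset y in H | _]%fset.
(* On each tile two points of the fiber follow the same ball center within [delta], so they can only
   be separated outside [T], where the old bound applies. *)
have sepH' : fset_separated act (D `\` T)%fset (delta + delta) H'.
  apply: fset_separatedD; first by rewrite addr_ge0// ltW.
    by move=> y z; rewrite !inE /= => /andP[yH _] /andP[zH _]; exact: sepH.
  move=> y z; rewrite !inE /= => /andP[yH /eqP yy0] /andP[zH /eqP zy0] t.
  move=> /bigfcupP[c]; rewrite andbT in_rtranslate => cS tc.
  have cA := fsubsetP SA _ cS.
  have [_ yc] := iP y yH c cA; have [_ zc] := iP z zH c cA.
  rewrite phiS// in yc; rewrite phiS// in zc.
  have /(dynamical_dist_ltP _ _ _ _ delta0)/(_ _ tc) := yc.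
  have /(dynamical_dist_ltP _ _ _ _ delta0)/(_ _ tc) := zc.
  rewrite -!actM !mulgVK; set p := act _ (c_ _ _) => pz py.
  rewrite (le_trans (metric_triangle _ p _))// lerD// ltW//.
  by rewrite metric_sym.
have H'D y : y \in H' -> forall g, g \in (D `\` T)%fset ->
    mdist (act g x) (act g y) <= e.
  rewrite !inE /= => /andP[yH _] g; rewrite inE => /andP[_ gD].
  exact: HD.
apply: le_trans (boundK0 _ _ _ H'D sepH') _.
rewrite (weight_prod (S := S y0) (w := fun g (j : 'I_b) =>
  if (j : nat) \in I_ (act g x) then v g j else 0)
  (v := fun g => lambda * #|` F (ky y0 g)|%:R) (f := phi y0))//; last 2 first.
- by move=> g gS; rewrite ffunE (negbTE gS).
- move=> g gS; have gA : val g \in A by exact: valP.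
  exists (Ordinal (iyP y0 (val g) y0H gA)).
    by rewrite ffunE gS (insubT (fun i => (i < b)%N) (iyP y0 _ y0H gA)).
  by rewrite /=; have [-> _] := iP y0 y0H _ gA.
rewrite -expRD ler_expR -mulr_sumr addrAC.
apply: (@improve_exponent _ _ a _ _ eta' _ _ #|` T|%:R) => //.
- by apply: sumr_ge0.
- by rewrite /eta mulrCA divff ?mulr1.
- by rewrite ler_nat fsubset_leq_card.
- have -> : d - beta = #|` A|%:R.
    by rewrite cardfsDS ?natrB ?fsubset_leq_card//; apply: fset_sub.
  by rewrite /kappa ler_pdivrMl// ltr_pwDl ?invr_gt0// divr_ge0// ltW.
- by rewrite cardfsDS// natrB// fsubset_leq_card.
rewrite (@le_trans _ _ (#|` boundary K0 D|%:R + (\sum_(c <- S y0) defect K0 (F (ky y0 c)))%:R))//.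
  by rewrite -natrD ler_nat boundary_setD_tiling.
apply: lerD; first by rewrite ler_nat boundary_mono// fsubsetUl.
rewrite natr_sum mulr_sumr big_seq [leRHS]big_seq; apply: ler_sum => c cS.
by apply: k0P => /=; have /andP[] := kyP y0 c y0H (fsubsetP SA _ cS).
Qed.

Lemma entropy_bound_mono e r h h' : h <= h' ->
  entropy_bound e r h -> entropy_bound e r h'.
Proof.
move=> hh' [K [M [M0 boundK]]]; exists K, M; split => // D x H HD sepH.
rewrite (le_trans (boundK D x H HD sepH))// ler_expR lerD2r.
by rewrite ler_wpM2r.
Qed.

(** The infimum of the admissible exponents above l' = lambda / (1 - a) must be at most l':
    otherwise one improvement of a nearly minimal exponent would fall below it. *)
Lemma entropy_bound_of_htopB (F : nat -> {fset G}) (lambda delta e h : R) :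
  continuous_action act -> compact [set: X] -> folner R F -> tempered R F ->
  0 < delta -> 0 <= lambda ->
  (forall x, htopB act F (Gamma act e x) delta < lambda%:E)%E ->
  lambda < h -> entropy_bound e (delta + delta) h.
Proof.
move=> actP Xcompact folnerF [C C0 temperedF] delta0 lambda0 hB lh.
have h0 : 0 < h by exact: le_lt_trans lh.
have r0 : 0 < delta + delta by rewrite addr_gt0.
(* This makes h (1 - a) = (h + lambda) / 2 > lambda, that is, l' < h. *)
pose a := (h - lambda) / (2 * h).
have a01 : 0 < a < 1.
  rewrite divr_gt0 ?mulr_gt0// ?subr_gt0//= ltr_pdivrMr ?mulr_gt0//; lra.
have /andP[a0 a1] := a01.
have b0 : 0 < 1 - a by rewrite subr_gt0.
set l' := lambda / (1 - a).
have l'h : l' < h.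
  rewrite /l' ltr_pdivrMr// mulrBr mulr1 /a.
  have -> : h * ((h - lambda) / (2 * h)) = (h - lambda) / 2.
    by rewrite invfM mulrCA; congr (_ * _); rewrite mulrCA divff ?gt_eqF// mulr1.
  lra.
pose kappa := (a^-1 + C / (1 - a))^-1.
have kappa0' : 0 < a^-1 + C / (1 - a).
  by rewrite ltr_pwDl ?invr_gt0// divr_ge0// ltW.
have kappa0 : 0 < kappa by rewrite invr_gt0.
(* This keeps the improved exponent above l', hence in the set [E] below. *)
have kappa1 : kappa < 1.
  rewrite invf_lt1// (@lt_le_trans _ _ a^-1)// ?invf_gt1//.
  by rewrite lerDl divr_ge0 ?ltW.
have step t : l' < t -> entropy_bound e (delta + delta) t ->
    entropy_bound e (delta + delta) (t - kappa * (t - l') / 2).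
  exact: (entropy_bound_improve actP Xcompact folnerF temperedF (ltW C0) a01
    delta0 lambda0 hB).
pose E := [set t | l' < t /\ entropy_bound e (delta + delta) t].
have E0 : E !=set0.
  have [t bt] := entropy_bound_trivial e Xcompact r0.
  exists (Num.max t h); split; first by rewrite lt_max l'h orbT.
  by apply: entropy_bound_mono bt; rewrite le_max lexx.
have Elb : lbound E l' by move=> t [/ltW].
have infE : inf E <= l'.
  rewrite leNgt; apply/negP => li.
  have Einf : has_inf E by split=> //; exists l'.
  have eps0 : 0 < kappa * (inf E - l') / 2 by rewrite divr_gt0// mulr_gt0// subr_gt0.
  have [t [lt bt] ti] := inf_adherent eps0 Einf.
  have it : inf E <= t by apply: ge_inf => //; exists l'.
  have : inf E <= t - kappa * (t - l') / 2.
    apply: ge_inf; first by exists l'.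
    split; last exact: step.
    have : kappa * (t - l') < t - l' by rewrite gtr_pMl// subr_gt0.
    lra.
  have : kappa * (inf E - l') <= kappa * (t - l') by rewrite ler_pM2l// lerD2r.
  lra.
have Einf : has_inf E by split=> //; exists l'.
have := inf_lt E0 (le_lt_trans infE l'h).
by move=> [t [_ bt] th]; apply: entropy_bound_mono bt; exact: ltW.
Qed.

End Core.

(** * Comparison of the entropies *)

Section Limsup.
Context (R : realType) (T : choiceType) (Y : filteredType T).
Implicit Types (f : Y -> \bar R) (H : set_system Y).

Lemma limf_esup_le f H (c : \bar R) {FH : Filter H} :
  (\forall x \near H, (f x <= c)%E) -> (limf_esup f H <= c)%E.
Proof.
move=> fc; apply: ge_ereal_inf; exists (ereal_sup (f @` [set x | (f x <= c)%E])).
  by exists [set x | (f x <= c)%E].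
by apply: ge_ereal_sup => _ [x fxc <-].
Qed.

Lemma limf_esup_lt f H (c : \bar R) {FH : Filter H} :
  (limf_esup f H < c)%E -> \forall x \near H, (f x < c)%E.
Proof.
move=> /ereal_inf_lt[_ [V HV <-]] Vc; apply: filterS HV => x Vx.
by apply: le_lt_trans Vc; apply: ereal_sup_ubound; exists x.
Qed.

End Limsup.

Section Htop.
Context (R : realType) (G : groupType) (X : metricType R) (act : G -> X -> X).
Variable F : nat -> {fset G}.
Implicit Types (Z : set X) (r delta : R).

Lemma sep_number_ge1 E Z r : Z !=set0 -> (1 <= sep_number act E Z r)%E.
Proof.
move=> [z Zz]; apply: ereal_sup_ubound; exists [fset z]%fset; last by rewrite cardfs1.
split=> [x|x y]; first by rewrite /= inE => /eqP ->.
by rewrite !inE => /eqP -> /eqP ->; rewrite eqxx.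
Qed.

Lemma htop_ge0 Z r : Z !=set0 -> (0 <= htop act F Z r)%E.
Proof.
move=> Z0; apply: limf_esup_ge0 => [|n].
  by case=> n _ /(_ n (leqnn n)).
by rewrite mule_ge0 ?lee_fin ?invr_ge0// lne_ge0 sep_number_ge1.
Qed.

Lemma htop_mono Z Z' r : Z !=set0 -> Z `<=` Z' ->
  (htop act F Z r <= htop act F Z' r)%E.
Proof.
move=> Z0 ZZ'; apply: le_ereal_inf_tmp => _ [V V0 <-].
apply: ge_ereal_inf; exists (ereal_sup [set ((#|` F n|%:R^-1)%:E * lne (sep_number act (F n) Z r))%E | n in V]).
  by exists V.
apply: ge_ereal_sup => _ [n Vn <-].
apply: le_trans; last by apply: ereal_sup_ubound; exists n.
have Z'0 : Z' !=set0 by case: Z0 => z /ZZ' ?; exists z.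
rewrite lee_wpmul2l ?lee_fin ?invr_ge0// lee_lne ?in_itv/= ?leey ?andbT.
- by apply: ereal_sup_le => _ [H [HZ sepH] <-]; exists H => //; split => // x /HZ /ZZ'.
- by rewrite (le_trans _ (sep_number_ge1 _ _ Z0)).
- by rewrite (le_trans _ (sep_number_ge1 _ _ Z'0)).
Qed.

(** An entropy bound concerns only sets of d_D-radius [e]. Coding orbits over F_n by a net of mesh e
    / 2 cuts [X] into |S|^|F_n| such sets, at the cost ln |S|, which is independent of [r]. The
    boundary term is negligible along a Folner sequence. *)
Lemma htop_le_entropy_bound e : [set: X] !=set0 -> compact [set: X] ->
  folner R F -> 0 < e -> exists2 c : R, 0 <= c & forall r h,
    entropy_bound act e r h -> (htop act F [set: X] r <= (c + h)%:E)%E.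
Proof.
move=> X0 Xcompact folnerF e0; have F0 := folnerF.1.
have e2 : 0 < e / 2 by rewrite divr_gt0.
have [S netS] := compact_finite_net Xcompact e2.
have S1 : 1 <= #|` S|%:R :> R.
  have [x _] := X0; have [s sS _] := netS x.
  by rewrite ler1n cardfs_gt0; apply/fset0Pn; exists s.
exists (ln #|` S|%:R); first exact: ln_ge0.
move=> r h [K [M [M0 boundK]]].
apply/lee_addgt0Pr => eta eta0.
pose eta' := eta / (M + 1).
have M1 : 0 < M + 1 by rewrite ltr_wpDl.
have eta'0 : 0 < eta' by rewrite divr_gt0.
apply: limf_esup_le; apply: filterS (folner_defect K folnerF eta'0) => n nK.
have Fn0 : 0 < #|` F n|%:R :> R by rewrite ltr0n cardfs_gt0.
pose B := expR ((ln #|` S|%:R + h + eta) * #|` F n|%:R).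
have sepB : (sep_number act (F n) [set: X] r <= B%:E)%E.
  apply: ge_ereal_sup => _ [H [_ sepH] <-]; rewrite lee_fin.
  have [phi phiP] := finite_coding act (F n) e2 netS.
  apply: le_trans (_ : \sum_(f : {ffun F n -> S})
      expR (h * #|` F n|%:R + M * #|` boundary K (F n)|%:R) <= _).
    apply: (card_le_sum_fibers (phi := phi)) => f.
    have [->|/fset0Pn[x]] := eqVneq [fset y in H | phi y == f]%fset fset0.
      by rewrite cardfs0 expR_ge0.
    rewrite !inE /= => /andP[_ /eqP xf]; apply: (boundK (F n) x) => [y|y z].
      rewrite !inE /= => /andP[_ /eqP yf] g gF.
      by rewrite [leRHS]splitr ltW// (phiP x y)// xf.
    by rewrite !inE /= => /andP[yH _] /andP[zH _]; exact: sepH.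
  rewrite sumr_const card_ffun -!cardfE -[expR _ *+ _]mulr_natl natrX.
  rewrite -[X in X ^+ _](@lnK R) ?posrE ?(lt_le_trans _ S1)// -expRM_natr -expRD.
  rewrite ler_expR !mulrDl -addrA lerD2l lerD2l.
  apply: (@le_trans _ _ (M * (eta' * #|` F n|%:R))).
    by rewrite ler_wpM2l// (le_trans _ nK)// ler_nat boundary_le_defect.
  rewrite mulrA ler_wpM2r// /eta' mulrCA ger_pMr// ler_pdivrMr// mul1r.
  by rewrite lerDl.
apply: (@le_trans _ _ ((#|` F n|%:R^-1)%:E * lne B%:E)%E).
  rewrite lee_wpmul2l ?lee_fin ?invr_ge0// lee_lne ?in_itv/= ?leey ?andbT//.
    by rewrite (le_trans _ (sep_number_ge1 _ _ X0)).
  by rewrite lee_fin expR_ge0.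
by rewrite lne_EFin ?expR_gt0// expRK -EFinM mulrC mulfK ?gt_eqF// EFinD.
Qed.

End Htop.

Section Comparison.
Context (R : realType) (G : groupType) (X : metricType R) (act : G -> X -> X).
Variable F : nat -> {fset G}.
Implicit Types (Z : set X) (lambda eps r delta : R).

Lemma htopB_ge0 Z delta : (0 <= htopB act F Z delta)%E.
Proof.
by apply: le_ereal_inf_tmp => _ [l [l0 _] <-]; rewrite lee_fin ltW.
Qed.

Lemma htopP_ge0 Z delta : (0 <= htopP act F Z delta)%E.
Proof.
by apply: le_ereal_inf_tmp => _ [l [l0 _] <-]; rewrite lee_fin ltW.
Qed.

Lemma htop_le_sup_htopB e : [set: X] !=set0 -> compact [set: X] ->
  continuous_action act -> folner R F -> tempered R F -> 0 < e ->
  exists2 c : R, 0 <= c & forall delta, 0 < delta ->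
    (htop act F [set: X] (delta + delta) <=
      c%:E + ereal_sup [set htopB act F (Gamma act e x) delta | x in [set: X]])%E.
Proof.
move=> X0 Xcompact actP folnerF temperedF e0.
have [c c0 cP] := htop_le_entropy_bound act X0 Xcompact folnerF e0.
exists c => // delta delta0.
have le_sup x : (htopB act F (Gamma act e x) delta <=
    ereal_sup [set htopB act F (Gamma act e x) delta | x in [set: X]])%E.
  by apply: ereal_sup_ubound; exists x.
have sup0 : (0 <= ereal_sup [set htopB act F (Gamma act e x) delta | x in [set: X]])%E.
  by have [x _] := X0; apply: le_trans (le_sup x); exact: htopB_ge0.
case: (ereal_sup _) le_sup sup0 => [s||//] le_sup sup0; last by rewrite addey// leey.
apply/lee_addgt0Pr => eta eta0; rewrite -!EFinD -addrA.
have s0 : 0 <= s by rewrite -lee_fin.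
apply: cP.
(* Half of [eta] makes the Bowen entropies strictly smaller than lambda, the other half makes lambda
   strictly smaller than the exponent. *)
apply: (@entropy_bound_of_htopB _ _ _ _ F (s + eta / 2)) => //.
- by rewrite addr_ge0// ltW// divr_gt0.
- by move=> x; rewrite (le_lt_trans (le_sup x))// lte_fin ltrDl divr_gt0.
- by rewrite ltrD2l gtr_pMr// invf_lt1// ltr1n.
Qed.

(** Disjoint balls have centers more than [delta] apart, so their number is bounded and a maximal
    family exists. By maximality the ball of any [z] in [Z] meets one of them, giving distance at
    most 2 delta, which the open ball of radius 3 delta contains. *)
Lemma packing_maximal E Z delta : [set: X] !=set0 -> compact [set: X] -> 0 < delta ->
  exists (m : nat) (c : nat -> X), [/\ forall j, (j < m)%N -> Z (c j),
    trivIset `I_m (fun j => dynamical_cball act E delta (c j)) &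
    Z `<=` \bigcup_(j in `I_m) dynamical_oball act E (delta + delta + delta) (c j)].
Proof.
move=> [x0 _] Xcompact delta0; have delta0' := ltW delta0.
have delta2 : 0 < delta / 2 by rewrite divr_gt0.
have [S netS] := compact_finite_net Xcompact delta2.
pose P (H : {fset X}) := [set` H] `<=` Z /\ {in H &, forall x y,
  dynamical_cball act E delta x `&` dynamical_cball act E delta y !=set0 -> x = y}.
have self x : dynamical_cball act E delta x x.
  by apply/dynamical_dist_leP => // g _; rewrite mdistxx.
have P0 : P fset0 by split=> x; rewrite /= inE.
have PN H : P H -> (#|` H| <= #|` S| ^ #|` E|)%N.
  move=> [_ Hdisj]; apply: separated_card_le delta0 netS _ => x y xH yH /eqP xy.
  rewrite ltNge; apply/negP => dxy; apply: xy; apply: Hdisj => //.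
  by exists y; split; [exact: dxy|exact: self].
have [H [HZ Hdisj] maxH] := maximal_bounded_fset P0 PN.
exists #|` H|, (nth x0 H); split.
- by move=> j jm; apply: HZ; rewrite /= mem_nth.
- move=> i j /= im jm /Hdisj; rewrite !mem_nth// => /(_ isT isT) /eqP.
  by rewrite nth_uniq ?fset_uniq// => /eqP.
move=> z Zz.
suff [s sH zs] : exists2 s, s \in H &
    dynamical_oball act E (delta + delta + delta) s z.
  by exists (index s H) => /=; rewrite ?index_mem// nth_index.
have d3 : 0 < delta + delta + delta by rewrite !addr_gt0.
have [zH|zH] := boolP (z \in H).
  exists z => //; apply/dynamical_dist_ltP => // g _; by rewrite mdistxx.
apply: contrapT => far; apply: (maxH z zH); split.
  by move=> x /=; rewrite !inE => /orP[/eqP ->//|/HZ].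
have disj s : s \in H ->
    ~ ((dynamical_cball act E delta z `&` dynamical_cball act E delta s) !=set0).
  move=> sH [w [/(dynamical_dist_leP _ _ _ _ delta0') zw]].
  move=> /(dynamical_dist_leP _ _ _ _ delta0') sw.
  apply: far; exists s => //; apply/dynamical_dist_ltP => // g gE.
  have := metric_triangle (act g s) (act g w) (act g z).
  rewrite (metric_sym (act g w)); have := zw g gE; have := sw g gE; lra.
move=> x y; rewrite !inE => /orP[/eqP ->|xH] /orP[/eqP ->//|yH].
- by move=> /disj-/(_ yH).
- by rewrite setIC => /disj-/(_ xH).
- exact: Hdisj.
Qed.

End Comparison.

(** * Bowen entropy bounded by packing entropy *)

Section Packing.
Context (R : realType) (G : groupType) (X : metricType R) (act : G -> X -> X).
Variable F : nat -> {fset G}.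
Implicit Types (Z : set X) (lambda eps r delta : R).
Hypothesis X0 : [set: X] !=set0.

Lemma packing_pre_ge0 lambda eps delta Z :
  (0 <= packing_pre act F lambda eps delta Z)%E.
Proof.
have [x _] := X0; apply: ereal_sup_ubound.
exists set0, (fun=> 0%N), (fun=> x); split; last by rewrite /family_sum esum_set0.
by split=> // i j [].
Qed.

Lemma packing_limE lambda delta Z : packing_lim act F lambda delta Z =
  ereal_inf [set packing_pre act F lambda eps delta Z | eps in [set eps | 0 < eps]].
Proof.
rewrite /packing_lim.
rewrite (_ : [set eps | 0 < eps] = [set` `]0, +oo[%R]); last first.
  by apply/seteqP; split => x /=; rewrite in_itv/= andbT.
apply/cvg_lim => //; apply: nondecreasing_at_right_cvge => //.
move=> s t; rewrite !in_itv/= !andbT => s0 t0 st.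
apply: ereal_sup_le => _ [I [k [c [[IZ Ik disj] ->]]]]; exists I, k, c; split => //.
by split => // i Ii; rewrite (le_trans _ (Ik i Ii))// lef_pV2.
Qed.

Lemma packing_lim_ge0 lambda delta Z : (0 <= packing_lim act F lambda delta Z)%E.
Proof.
rewrite packing_limE; apply: le_ereal_inf_tmp => _ [eps _ <-].
exact: packing_pre_ge0.
Qed.

Lemma bowen_lim_eq0P lambda delta Z :
  (forall eps nu : R, 0 < eps -> 0 < nu ->
    (bowen_pre act F lambda eps delta Z <= nu%:E)%E) ->
  bowen_lim act F lambda delta Z = 0%E.
Proof.
move=> small; rewrite bowen_limE; apply/eqP; rewrite eq_le; apply/andP; split.
  apply: ge_ereal_sup => _ [eps eps0 <-]; apply/lee_addgt0Pr => nu nu0.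
  by rewrite add0e small.
apply: le_ereal_sup_tmp; exists (bowen_pre act F lambda 1 delta Z).
  by exists 1 => //=.
exact: bowen_pre_ge0.
Qed.

(** Each piece of a near-optimal decomposition is covered with a single large shape: a maximal
    disjoint family is an admissible packing, so its weight is controlled, and its tripled balls
    cover the piece. *)
Lemma htopB_le_htopP Z delta : compact [set: X] -> 0 < delta ->
  (forall N, exists n, N <= #|` F n|)%N ->
  (htopB act F Z (delta + delta + delta) <= htopP act F Z delta)%E.
Proof.
move=> Xcompact delta0 Flarge; set delta3 := delta + delta + delta.
apply: le_ereal_inf_tmp => _ [lambda [lambda0 out0] <-].
apply: ereal_inf_lbound; exists lambda => //; split => //.
apply: bowen_lim_eq0P => eps nu eps0 nu0.
have nu20 : 0 < nu / 2 by rewrite divr_gt0.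
have : (packing_outer act F lambda delta Z < (nu / 2)%:E)%E by rewrite out0 lte_fin.
move=> /ereal_inf_lt[_ [Zs ZZs <-]] Zssum.
pose a i := packing_lim act F lambda delta (Zs i).
(* The triple [p] holds the shape index, the number of balls and their centers. The errors add up to
   nu / 2. *)
have local i : exists p : nat * nat * (nat -> X), [/\ eps^-1 <= #|` F p.1.1|%:R,
    Zs i `<=` \bigcup_(j in `I_p.1.2) dynamical_oball act (F p.1.1) delta3 (p.2 j) &
    (family_sum F lambda `I_p.1.2 (fun=> p.1.1) <=
      a i + (nu / 2 / (2 ^ i.+1)%:R)%:E)%E].
  have nui : 0 < nu / 2 / (2 ^ i.+1)%:R by rewrite divr_gt0// ltr0n expn_gt0.
  suff [t t0 pre] : exists2 t, 0 < t &
      (packing_pre act F lambda t delta (Zs i) <= a i + (nu / 2 / (2 ^ i.+1)%:R)%:E)%E.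
    (* The shape must be admissible both for the covering at [eps] and for the packing at [t]; the
       sum dominates both thresholds. *)
    have [n Fn] := Flarge (Num.bound (eps^-1 + t^-1)).
    have {}Fn : eps^-1 + t^-1 <= #|` F n|%:R.
      rewrite (le_trans (ltW (archi_boundP _)))// ?ler_nat//.
      by rewrite addr_ge0// invr_ge0 ltW.
    have epsn : eps^-1 <= #|` F n|%:R by rewrite (le_trans _ Fn)// lerDl invr_ge0 ltW.
    have tn : t^-1 <= #|` F n|%:R by rewrite (le_trans _ Fn)// lerDr invr_ge0 ltW.
    have [m [c [cZ disj cov]]] := packing_maximal act (F n) (Zs i) X0 Xcompact delta0.
    exists (n, m, c); split => //=; apply: le_trans pre.
    by apply: ereal_sup_ubound; exists `I_m, (fun=> n), c.
  have [afin|] := boolP (a i \is a fin_num); last first.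
    rewrite ge0_fin_numE ?packing_lim_ge0// -leNgt leye_eq => /eqP ->.
    by exists 1 => //; rewrite addye// leey.
  have : (a i < a i + (nu / 2 / (2 ^ i.+1)%:R)%:E)%E by rewrite lteDl.
  rewrite {1}/a packing_limE => /ereal_inf_lt[_ [t t0 <-] /ltW pre].
  by exists t.
have [p pP] := choice local.
(* The pairs (piece, ball) are renumbered by integers; the default (0, 0) is only taken outside the
   index set. *)
pose u (q : nat) : nat * nat := odflt (0, 0)%N (choice.unpickle q).
have uK (q : nat * nat) : u (choice.pickle q) = q by rewrite /u choice.pickleK.
pose P := [set: nat] `*`` (fun i => `I_(p i).1.2).
apply: ge_ereal_inf; exists (family_sum F lambda (choice.pickle @` P) (fun q => (p (u q).1).1.1)).
  exists (choice.pickle @` P), (fun q => (p (u q).1).1.1), (fun q => (p (u q).1).2 (u q).2).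
  split => //; split => [_ [q Pq <-]|z /ZZs[i _ Zi]].
    by rewrite uK; have [] := pP q.1.
  have [_ /(_ _ Zi)[j jm zj] _] := pP i.
  by exists (choice.pickle (i, j)); [exists (i, j)|rewrite uK].
have inj : set_inj P (@choice.pickle (nat * nat)%type).
  by move=> q q' _ _ /(congr1 u); rewrite !uK.
rewrite /family_sum (esum_image P _ _ inj).
under eq_esum do rewrite uK.
rewrite -(@esum_esum R _ _ setT (fun i => `I_(p i).1.2)
  (fun i _ => (expR (- (lambda * #|` F (p i).1.1|%:R)))%:E)); last first.
  by move=> i j _ _; rewrite lee_fin expR_ge0.
apply: (@le_trans _ _ (\esum_(i in [set: nat]) (a i + (nu / 2 / (2 ^ i.+1)%:R)%:E))%E).
  by apply: le_esum => i _; have [] := pP i.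
rewrite -nneseries_esumT; last first.
  move=> i; rewrite adde_ge0 ?packing_lim_ge0// lee_fin divr_ge0// ltW//.
apply: le_trans (epsilon_trick _ _ _) _; first by move=> i; exact: packing_lim_ge0.
  exact: ltW.
by rewrite [in leRHS](splitr nu) EFinD leeD2r// ltW.
Qed.

End Packing.

(** * Consequences of the growth condition *)

Section Growth.
Context (R : realType) (G : groupType).
Variable F : nat -> {fset G}.
Hypothesis Fgrowth : (#|` F n|%:R / ln n.+1%:R : R) @[n --> \oo] --> +oo.

Lemma growth_ln (A : R) :
  \forall n \near \oo, A * ln n.+1%:R <= #|` F n|%:R.
Proof.
have /cvgryPge/(_ A) := Fgrowth; move=> FA; near=> n.
have ln0 : 0 < ln n.+1%:R :> R.
  by rewrite ln_gt0// ltr1n ltnS; near: n; exists 1%N.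
by rewrite -ler_pdivlMr//; near: n.
Unshelve. all: by end_near. Qed.

Lemma growth_unbounded N : exists n, (N <= #|` F n|)%N.
Proof.
have [n0 _ n0P] := growth_ln 1.
pose n := maxn n0 (Num.bound (expR N%:R : R)).
exists n; rewrite -(ler_nat R); apply: le_trans (n0P n _); last exact: leq_maxl.
rewrite mul1r -[leLHS]expRK ler_ln ?posrE ?expR_gt0//.
rewrite (le_trans (ltW (archi_boundP (expR_ge0 _))))// ler_nat.
by rewrite (leq_trans (leq_maxr n0 _))// leqnSn.
Qed.

(** Telescoping, from 1 / (n+1)^2 <= 1 / n - 1 / (n+1). *)
Lemma sum_inv_sq_le (N m : nat) : (0 < N)%N ->
  \sum_(N <= n < m) (n.+1%:R ^- 2 : R) <= N%:R^-1.
Proof.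
move=> N0; have [Nm|mN] := leqP N m; last by rewrite big_geq ?invr_ge0// ltnW.
apply: (@le_trans _ _ (\sum_(N <= n < m) (- n.+1%:R^-1 - (- n%:R^-1)))).
  rewrite big_nat_cond [leRHS]big_nat_cond; apply: ler_sum => n.
  rewrite andbT => /andP[Nn _]; have n0 : (0 < n%:R :> R) by rewrite ltr0n (leq_trans N0).
  have n1 : (0 < n.+1%:R :> R) by rewrite ltr0n.
  have -> : - n.+1%:R^-1 - - n%:R^-1 = n%:R^-1 * n.+1%:R^-1 :> R.
    have i1 : n%:R^-1 * n%:R = 1 :> R by rewrite mulVf ?gt_eqF.
    have j1 : n.+1%:R^-1 * n.+1%:R = 1 :> R by rewrite mulVf ?gt_eqF.
    transitivity (n%:R^-1 * n.+1%:R^-1 * (n.+1%:R - n%:R) : R).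
      rewrite mulrBr -mulrA j1 mulr1 [X in _ - X * _]mulrC -mulrA i1 mulr1.
      by rewrite opprK addrC.
    by rewrite -natrB// subSnn mulr1.
  by rewrite expr2 invfM ler_wpM2r ?invr_ge0// lef_pV2 ?posrE// ler_nat.
rewrite telescope_sumr// opprK addrC.
by rewrite lerBlDr lerDl invr_ge0.
Qed.

End Growth.

Section PackingTop.
Context (R : realType) (G : groupType) (X : metricType R) (act : G -> X -> X).
Variable F : nat -> {fset G}.
Hypothesis F0 : forall n, F n != fset0.
Hypothesis Fgrowth : (#|` F n|%:R / ln n.+1%:R : R) @[n --> \oo] --> +oo.
Hypothesis X0 : [set: X] !=set0.

Lemma sep_number_le_of_htop Z delta (t : R) : Z !=set0 ->
  (htop act F Z delta < t%:E)%E ->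
  \forall n \near \oo, (sep_number act (F n) Z delta <= (expR (t * #|` F n|%:R))%:E)%E.
Proof.
move=> Z0 /limf_esup_lt; apply: filterS => n.
have Fn0 : 0 < #|` F n|%:R :> R by rewrite ltr0n cardfs_gt0.
have := sep_number_ge1 act (F n) delta Z0.
case: (sep_number _ _ _ _) => [s||]//=.
  rewrite lee_fin => s1; have s0 : 0 < s by exact: lt_le_trans s1.
  rewrite leNgt s0 /= -EFinM lte_fin ltr_pdivrMl// mulrC => lns.
  by rewrite lee_fin -[leLHS]lnK ?posrE// ler_expR ltW.
by rewrite gt0_muley ?lte_fin ?invr_gt0.
Qed.

(** Group the balls by shape: the centers for shape F_n are separated, so there are at most exp (mu
    |F_n|) of them, and the growth hypothesis reduces their total weight to at most (n+1)^-2. *)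
Lemma packing_finite_sum (J : {fset nat}) (k : nat -> nat) (c : nat -> X)
    (Z : set X) (lambda mu delta : R) (N : nat) : (0 < N)%N -> 0 < delta ->
  (forall i, i \in J -> Z (c i)) ->
  (forall i, i \in J -> (N <= k i)%N) ->
  {in J &, forall i j, dynamical_cball act (F (k i)) delta (c i) `&`
     dynamical_cball act (F (k j)) delta (c j) !=set0 -> i = j} ->
  (forall n, (N <= n)%N ->
    (sep_number act (F n) Z delta <= (expR (mu * #|` F n|%:R))%:E)%E) ->
  (forall n, (N <= n)%N -> 2 * ln n.+1%:R <= (lambda - mu) * #|` F n|%:R) ->
  \sum_(i <- J) expR (- (lambda * #|` F (k i)|%:R)) <= N%:R^-1.
Proof.
move=> N0 delta0 JZ JN Jdisj sepF lnF; have delta0' := ltW delta0.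
pose w n : R := expR (- (lambda * #|` F n|%:R)).
pose m := (\max_(i <- J) (k i).+1)%N.
have km i : i \in J -> (k i < m)%N by move=> iJ; apply: leq_bigmax_seq.
pose Jn n := [fset i in J | k i == n]%fset.
have -> : \sum_(i <- J) w (k i) = \sum_(N <= n < m) #|` Jn n|%:R * w n.
  under [RHS]eq_bigr do rewrite card_fset_pred natr_sum mulr_suml.
  rewrite exchange_big /= big_seq [RHS]big_seq; apply: eq_bigr => i iJ.
  rewrite (bigD1_seq (k i)) ?iota_uniq//=; last by rewrite mem_index_iota JN// km.
  rewrite eqxx mul1r big1 ?addr0// => n; rewrite eq_sym => /negbTE ->.
  by rewrite mul0r.
apply: le_trans (sum_inv_sq_le R m N0).
rewrite big_nat_cond [leRHS]big_nat_cond; apply: ler_sum => n.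
rewrite andbT => /andP[Nn _].
have self x : dynamical_cball act (F n) delta x x.
  by apply/dynamical_dist_leP => // g _; rewrite mdistxx.
(* Two balls of the same shape and center would intersect, so counting centers counts balls. *)
have cinj : {in Jn n &, injective c}.
  move=> i j; rewrite !inE /= => /andP[iJ /eqP ki] /andP[jJ /eqP kj] cij.
  by apply: Jdisj => //; exists (c i); rewrite ki kj cij; split; exact: self.
have Jsep : #|` Jn n|%:R <= expR (mu * #|` F n|%:R).
  rewrite -lee_fin; apply: le_trans (sepF n Nn).
  apply: ereal_sup_ubound; exists [fset c i | i in Jn n]%fset; last first.
    by rewrite card_in_imfset.
  split.
    by move=> x /= /imfsetP[i /=]; rewrite !inE /= => /andP[iJ _] ->; exact: JZ.
  move=> x y /imfsetP[i /= iJn ->] /imfsetP[j /= jJn ->] cij.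
  rewrite ltNge; apply/negP => dij; move/eqP: cij; apply; congr c.
  move: iJn jJn; rewrite !inE /= => /andP[iJ /eqP ki] /andP[jJ /eqP kj].
  apply: Jdisj => //; rewrite ki kj; exists (c j); split; [exact: dij|exact: self].
apply: (@le_trans _ _ (expR (mu * #|` F n|%:R) * w n)).
  by rewrite ler_wpM2r// expR_ge0.
rewrite /w -expRD -[X in _ <= X ^- 2]lnK ?posrE// -expRM_natl -expRN ler_expR.
by have := lnF n Nn; rewrite mulrBl; lra.
Qed.

(** For lambda above the topological entropy the packing sums tend to 0 already for [Z] itself, so
    the constant decomposition suffices. *)
Lemma htopP_le_htop Z delta : Z !=set0 -> 0 < delta ->
  (htopP act F Z delta <= htop act F Z delta)%E.
Proof.
move=> Z0 delta0; have := htop_ge0 act F delta Z0.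
case E : (htop act F Z delta) => [t||]// t0; last by rewrite leey.
rewrite lee_fin in t0.
apply/lee_addgt0Pr => eta eta0; rewrite -EFinD.
have eta20 : 0 < eta / 2 by rewrite divr_gt0.
apply: ereal_inf_lbound; exists (t + eta) => //; split; first by rewrite ltr_wpDl.
have lim0 : packing_lim act F (t + eta) delta Z = 0%E.
  apply/eqP; rewrite eq_le packing_lim_ge0// andbT packing_limE.
  apply/lee_addgt0Pr => nu nu0; rewrite add0e.
  have tlt : (htop act F Z delta < (t + eta / 2)%:E)%E by rewrite E lte_fin ltrDl.
  have [n1 _ sepF] := sep_number_le_of_htop Z0 tlt.
  (* The constant yields 2 ln (n+1) <= (eta / 2) |F_n|, where eta / 2 is the gap between the two
     exponents. *)
  have [n2 _ lnF] := growth_ln Fgrowth (2 / (eta / 2)).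
  pose N := (maxn n1 (maxn n2 (Num.bound nu^-1))).+1.
  have n1N : (n1 <= N)%N by rewrite leqW// leq_maxl.
  have n2N : (n2 <= N)%N by rewrite leqW// leq_max leq_maxl orbT.
  have Nnu : N%:R^-1 <= nu.
    rewrite -[leRHS]invrK lef_pV2 ?posrE ?invr_gt0//.
    rewrite (le_trans (ltW (archi_boundP _))) ?invr_ge0 ?(ltW nu0)//.
    by rewrite ler_nat leqW// !leq_max leqnn !orbT.
  (* Shapes with at least [M] elements have index at least [N]. *)
  pose M := (\max_(j < N) #|` F j|).+1.
  apply: ge_ereal_inf; exists (packing_pre act F (t + eta) M%:R^-1 delta Z).
    by exists M%:R^-1 => //=; rewrite invr_gt0.
  apply: ge_ereal_sup => _ [I [k [c [[IZ Ik disj] ->]]]].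
  apply: ge_ereal_sup => _ [A [finA AI] <-].
  rewrite fsbig_finite//= sumEFin lee_fin; apply: le_trans Nnu.
  have JI i : i \in fset_set A -> I i by rewrite in_fset_set// inE => /AI.
  apply: (@packing_finite_sum (fset_set A) k c Z (t + eta) (t + eta / 2) delta) => //.
  - by move=> i /JI; exact: IZ.
  - move=> i /JI Ii; rewrite leqNgt; apply/negP => ki.
    have := Ik i Ii; rewrite invrK ler_nat ltnNge.
    by rewrite -ltnS ltnS (leq_bigmax (Ordinal ki)).
  - by move=> i j /JI Ii /JI Ij; exact: disj.
  - by move=> n Nn; apply: sepF => /=; exact: leq_trans Nn.
  - move=> n Nn; have := lnF n (leq_trans n2N Nn).
    rewrite mulrAC ler_pdivrMr// => /le_trans; apply.
    by rewrite mulrC ler_wpM2r//; lra.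
apply/eqP; rewrite eq_le; apply/andP; split; last first.
  apply: le_ereal_inf_tmp => _ [Zs _ <-].
  by apply: nneseries_ge0 => i _ _; exact: packing_lim_ge0.
apply: ereal_inf_lbound; exists (fun=> Z); first by move=> z Zz; exists 0%N.
by rewrite eseries0.
Qed.

End PackingTop.

(** * Metric mean dimensions *)

Section Scaling.
Context (R : realType).
Implicit Types (f g : R -> \bar R).

Lemma lee_divr (L : R) (x y : \bar R) : 0 < L ->
  (y / L%:E <= x)%E = (y <= x * L%:E)%E.
Proof. by move=> L0; rewrite inver gt_eqF// lee_pdivrMr. Qed.

Lemma near_lnV_ge (A : R) : \forall delta \near 0^'+, A <= ln delta^-1.
Proof.
near=> delta; have delta0 : 0 < delta by [].
rewrite lnV ?posrE// lerNr -[leRHS]expRK ler_ln ?posrE ?expR_gt0//.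
by near: delta; apply: nbhs_right_le; exact: expR_gt0.
Unshelve. all: by end_near. Qed.

Lemma near_scale (P : R -> Prop) (a : R) : 0 < a ->
  (\forall delta \near 0^'+, P delta) -> \forall delta \near 0^'+, P (delta / a).
Proof.
move=> a0 nearP; have [r /= r0 rP] := nearP; near=> delta.
have delta0 : 0 < delta by [].
apply: rP => /=; last by rewrite divr_gt0.
rewrite sub0r normrN gtr0_norm ?divr_gt0// ltr_pdivrMr//.
near: delta; apply: nbhs_right_lt; exact: mulr_gt0.
Unshelve. all: by end_near. Qed.

Lemma limf_esup_near_le f g : (\forall delta \near 0^'+, (f delta <= g delta)%E) ->
  (limf_esup f 0^'+ <= limf_esup g 0^'+)%E.
Proof.
move=> fg; apply: le_ereal_inf_tmp => _ [V V0 <-]; apply: limf_esup_le.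
near=> delta; apply: (@le_trans _ _ (g delta)); first by near: delta.
by apply: ereal_sup_ubound; exists delta => //; near: delta.
Unshelve. all: by end_near. Qed.

(** The logarithms of 1 / delta and a / delta differ by the constant ln a, so neither the rescaling
    nor the additive constant survives division by a logarithm that tends to infinity. *)
Lemma limf_esup_scale f g (a c : R) : 0 < a ->
  (forall delta : R, 0 < delta -> (0 <= g delta)%E) ->
  (forall delta : R, 0 < delta -> (f (a * delta)%R <= c%:E + g delta)%E) ->
  (limf_esup (fun delta => f delta / (ln delta^-1)%:E) 0^'+ <=
   limf_esup (fun delta => g delta / (ln delta^-1)%:E) 0^'+)%E.
Proof.
move=> a0 g0 fg; set s := limf_esup (fun delta => g _ / _)%E _.
have s0 : (0 <= s)%E.
  rewrite leNgt; apply/negP => /limf_esup_lt sneg.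
  have [delta [[gneg L1] delta0]] : exists delta : R,
      ((g delta / (ln delta^-1)%:E < 0)%E /\ 1 <= ln delta^-1) /\ 0 < delta.
    by apply: (@filter_ex _ (0^'+ : set_system R)); near=> delta; split => //; split;
      near: delta => //; exact: near_lnV_ge.
  move: gneg; rewrite ltNge => /negP; apply.
  by rewrite mule_ge0 ?g0// inver gt_eqF ?(lt_le_trans _ L1)// lee_fin invr_ge0 (le_trans _ L1).
have [sfin|] := boolP (s \is a fin_num); last first.
  by rewrite ge0_fin_numE// -leNgt leye_eq => /eqP ->; rewrite leey.
apply/lee_addgt0Pr => eta eta0.
rewrite -(fineK sfin) -EFinD; set t := fine s.
have eta2 : 0 < eta / 2 by rewrite divr_gt0.
have : (s < (t + eta / 2)%:E)%E by rewrite -(fineK sfin) lte_fin ltrDl.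
move=> /limf_esup_lt /(near_scale a0) gt.
apply: limf_esup_le; near=> delta.
have delta0 : 0 < delta by [].
have L1 : 1 <= ln delta^-1 by near: delta; exact: near_lnV_ge.
have L0 : 0 < ln delta^-1 by exact: lt_le_trans L1.
have La1 : 1 <= ln (delta / a)^-1.
  by near: delta; apply: (near_scale (P := fun d => 1 <= ln d^-1) a0); exact: near_lnV_ge.
have La0 : 0 < ln (delta / a)^-1 by exact: lt_le_trans La1.
have LaE : ln (delta / a)^-1 = ln a + ln delta^-1.
  by rewrite invf_div lnM ?posrE ?invr_gt0.
(* This is c + (t + eta / 2) (ln a + L) <= (t + eta) L, solved for L = ln delta^-1. *)
have Lbig : 2 / eta * (c + (t + eta / 2) * ln a) <= ln delta^-1.
  by near: delta; exact: near_lnV_ge.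
rewrite lee_divr//.
have := fg _ (divr_gt0 delta0 a0); rewrite mulrC divfK ?gt_eqF// => /le_trans; apply.
have : (g (delta / a)%R / (ln (delta / a)^-1)%:E <= (t + eta / 2)%:E)%E.
  by apply: ltW; near: delta.
rewrite lee_divr// -EFinM => /(leeD2l c%:E) /le_trans; apply.
rewrite -EFinD -EFinM lee_fin LaE.
move: Lbig; rewrite mulrAC ler_pdivrMr//; lra.
Unshelve. all: by end_near. Qed.

End Scaling.

Section GammaMdim.
Context (R : realType) (G : groupType) (X : metricType R) (act : G -> X -> X).
Implicit Types h : set X -> R -> \bar R.

Definition Gamma_sup h (e : R) (delta : R) : \bar R :=
  ereal_sup [set h (Gamma act e x) delta | x in [set: X]].

(** Dividing by a positive real commutes with the supremum over [x], and ln delta^-1 is positive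
    near 0, which is all that the upper limit sees. *)
Lemma Gamma_mdimE h e : Gamma_mdim act h e =
  limf_esup (fun delta => Gamma_sup h e delta / (ln delta^-1)%:E)%E 0^'+.
Proof.
apply/eqP; rewrite eq_le; apply/andP; split; apply: limf_esup_near_le.
- near=> delta; have L1 : 1 <= ln delta^-1 by near: delta; exact: near_lnV_ge.
  have L0 : 0 < ln delta^-1 by exact: lt_le_trans L1.
  apply: ge_ereal_sup => _ [x _ <-].
  rewrite lee_wpmul2r//; first by rewrite inver gt_eqF// lee_fin invr_ge0 ltW.
  by apply: ereal_sup_ubound; exists x.
- near=> delta; have L1 : 1 <= ln delta^-1 by near: delta; exact: near_lnV_ge.
  have L0 : 0 < ln delta^-1 by exact: lt_le_trans L1.
  rewrite lee_divr//; apply: ge_ereal_sup => _ [x _ <-].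
  by rewrite -lee_divr//; apply: ereal_sup_ubound; exists x.
Unshelve. all: by end_near. Qed.

Lemma Gamma_sup_le h h' e delta delta' :
  (forall x, h (Gamma act e x) delta <= h' (Gamma act e x) delta')%E ->
  (Gamma_sup h e delta <= Gamma_sup h' e delta')%E.
Proof.
move=> hh'; apply: ge_ereal_sup => _ [x _ <-]; apply: le_trans (hh' x) _.
by apply: ereal_sup_ubound; exists x.
Qed.

Lemma Gamma_sup_ge0 h e delta : [set: X] !=set0 ->
  (forall x, 0 <= h (Gamma act e x) delta)%E -> (0 <= Gamma_sup h e delta)%E.
Proof.
move=> [x _] h0; apply: le_trans (h0 x) _.
by apply: ereal_sup_ubound; exists x.
Qed.

End GammaMdim.

Unset Implicit Arguments.

Theorem theorem2p3 (R : realType) (G : groupType) (X : metricType R)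
    (act : G -> X -> X) (F : nat -> {fset G})
    (Gcountable : ([set: G] #= [set: nat])%card)
    (Gamenable : amenable R G)
    (X0 : [set: X] !=set0) (Xcompact : compact [set: X])
    (actP : continuous_action act)
    (Ffolner : folner R F) (Ftempered : tempered R F)
    (Fgrowth : (#|` F n|%:R / ln n.+1%:R : R) @[n --> \oo] --> +oo)
    (e : R) (e0 : 0 < e) :
  [/\ upper_mdim act F = Gamma_mdim act (htop act F) e,
      Gamma_mdim act (htop act F) e = Gamma_mdim act (htopP act F) e &
      Gamma_mdim act (htopP act F) e = Gamma_mdim act (htopB act F) e].
Proof.
have F0 := Ffolner.1.
have Gamma0 x : Gamma act e x !=set0.
  by exists x => g; rewrite mdistxx ltW.
(* The four inequalities form a cycle: [X], Bowen, packing, topological, [X]. The scale factors are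
   2, 3, 1 and 1; only the first one carries an additive constant. *)
have top_B : (upper_mdim act F <= Gamma_mdim act (htopB act F) e)%E.
  have [c c0 cP] := htop_le_sup_htopB X0 Xcompact actP Ffolner Ftempered e0.
  rewrite Gamma_mdimE; apply: (@limf_esup_scale R _ _ 2 c) => // delta delta0.
    by apply: Gamma_sup_ge0 => // x; exact: htopB_ge0.
  by rewrite mulr_natl mulr2n; exact: cP.
have B_P : (Gamma_mdim act (htopB act F) e <= Gamma_mdim act (htopP act F) e)%E.
  rewrite !Gamma_mdimE; apply: (@limf_esup_scale R _ _ 3 0) => // delta delta0.
    by apply: Gamma_sup_ge0 => // x; exact: htopP_ge0.
  rewrite add0e mulr_natl !mulrS mulr0n addr0 addrA; apply: Gamma_sup_le => x.
  by apply: htopB_le_htopP => //; exact: growth_unbounded Fgrowth.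
have P_top : (Gamma_mdim act (htopP act F) e <= Gamma_mdim act (htop act F) e)%E.
  rewrite !Gamma_mdimE; apply: (@limf_esup_scale R _ _ 1 0) => // delta delta0.
    by apply: Gamma_sup_ge0 => // x; exact: htop_ge0.
  rewrite add0e mul1r; apply: Gamma_sup_le => x.
  exact: htopP_le_htop.
have top_X : (Gamma_mdim act (htop act F) e <= upper_mdim act F)%E.
  rewrite Gamma_mdimE; apply: (@limf_esup_scale R _ _ 1 0) => // delta delta0.
    exact: htop_ge0.
  rewrite add0e mul1r; apply: ge_ereal_sup => _ [x _ <-].
  exact: htop_mono.
split; apply: le_anti; apply/andP; split.
- exact: le_trans top_B (le_trans B_P P_top).
- exact: top_X.
- exact: le_trans top_X (le_trans top_B B_P).
- exact: P_top.
- exact: le_trans P_top (le_trans top_X top_B).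
- exact: B_P.
Qed.
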